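(* Let $A$ be a unital semisimple commutative Banach algebra and $B$ a unital commutative Banach algebra. Suppose that $T$ is a surjective group homomorphism from $A^{-1}$ onto $B^{-1}$ such that $$\sigma(Tf)=\sigma(f)$$ holds for every $f\in A^{-1}$. Then $T$ is extended to an algebra isomorphism from $A$ onto $B$. In particular, $B$ is semisimple.
   Context: Banach algebras are over $\mathbb{C}$. $A^{-1}$ denotes the group of invertible elements of $A$, and $\sigma(f)$ the spectrum of $f$ in the algebra containing it. *)

(* Defs.v *)
From HB Require Import structures.
From mathcomp Require Import all_boot all_order all_algebra.
From mathcomp Require Import ring_quotient complex.
From mathcomp Require Import all_classical all_reals all_analysis.

Set Implicit Arguments.
Unset Strict Implicit.
Unset Printing Implicit Defensive.

Import Order.TTheory GRing.Theory Num.Theory.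
Import numFieldNormedType.Exports.

Local Open Scope classical_set_scope.
Local Open Scope ring_scope.

(* A unital commutative Banach algebra is a Banach space with a product.
   The product is not given as a [GRing] ring structure on the same carrier
   because Hierarchy Builder admits no join of [NormedModule] and [NzRing]
   that is not already a [NumDomain]; the ring structure is put on the
   convertible alias [alg A] below.
   The norm takes its values in the scalar field [K], as in
   [completeNormedModType K]: for [K = R[i]] it is a nonnegative real number
   embedded in [R[i]]. The zero algebra is excluded, but the normalization
   [`|1| = 1] is not required. *)
HB.mixin Record NormedModule_isComBanachAlgebra (K : numFieldType) A
    of NormedModule K A := {
  bmul : A -> A -> A;
  bone : A;
  bmulA : associative bmul;
  bmulC : commutative bmul;
  bmul1 : left_id bone bmul;
  bmulDl : left_distributive bmul +%R;
  bscaleAl : forall (a : K) (x y : A), a *: bmul x y = bmul (a *: x) y;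
  bone_neq0 : bone != 0;
  normr_bmul_le : forall x y : A, `|bmul x y| <= `|x| * `|y|
}.

#[short(type="comBanachAlgType")]
HB.structure Definition ComBanachAlgebra (K : numFieldType) :=
  {A of CompleteNormedModule K A & NormedModule_isComBanachAlgebra K A}.

Definition alg (K : numFieldType) (A : comBanachAlgType K) : Type := A.

Section AlgebraStructure.
Variables (K : numFieldType) (A : comBanachAlgType K).

HB.instance Definition _ := GRing.Lmodule.copy (alg A) A.

HB.instance Definition _ := GRing.Zmodule_isComNzRing.Build (alg A)
  (@bmulA K A) (@bmulC K A) (@bmul1 K A) (@bmulDl K A) (@bone_neq0 K A).

HB.instance Definition _ := GRing.Lmodule_isLalgebra.Build K (alg A)
  (@bscaleAl K A).

HB.instance Definition _ := GRing.Lalgebra_isComAlgebra.Build K (alg A).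

Definition alg_unit : pred (alg A) := fun x => `[< exists y, y * x = 1 >].

Definition alg_inv (x : alg A) : alg A := xget x [set y | y * x = 1].

Lemma alg_mulVr : {in alg_unit, left_inverse 1 alg_inv *%R}.
Proof.
move=> x /asboolP[y yx1]; rewrite /alg_inv.
by case: xgetP => [z _ //|/(_ y)].
Qed.

Lemma alg_unitPl (x y : alg A) : y * x = 1 -> alg_unit x.
Proof. by move=> yx1; apply/asboolP; exists y. Qed.

Lemma alg_inv_out : {in [predC alg_unit], alg_inv =1 id}.
Proof.
move=> x; rewrite inE => /asboolPn nux; rewrite /alg_inv.
by case: xgetP => [z _ zx1|//]; case: nux; exists z.
Qed.

HB.instance Definition _ := GRing.ComNzRing_hasMulInverse.Build (alg A)
  alg_mulVr alg_unitPl alg_inv_out.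

End AlgebraStructure.

(* The library's group of units [{unit R}] is restricted to finite rings. *)
Section UnitGroup.
Variable A : comUnitRingType.

Record unit_group := UnitGroup {
  unit_val : A;
  unit_valP : unit_val \is a GRing.unit
}.

HB.instance Definition _ := [isSub for unit_val].
HB.instance Definition _ := [Choice of unit_group by <:].

Implicit Types x y z : unit_group.

Definition unit_group_one := UnitGroup (unitr1 A).

Lemma unit_group_inv_subproof x : (unit_val x)^-1 \is a GRing.unit.
Proof. by rewrite unitrV unit_valP. Qed.
Definition unit_group_inv x := UnitGroup (unit_group_inv_subproof x).

Lemma unit_group_mul_subproof x y :
  unit_val x * unit_val y \is a GRing.unit.
Proof. by rewrite unitrM !unit_valP. Qed.
Definition unit_group_mul x y := UnitGroup (unit_group_mul_subproof x y).

Lemma unit_group_mulA : associative unit_group_mul.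
Proof. by move=> x y z; apply/val_inj/mulrA. Qed.

Lemma unit_group_mul1 : left_id unit_group_one unit_group_mul.
Proof. by move=> x; apply/val_inj/mul1r. Qed.

Lemma unit_group_mulr1 : right_id unit_group_one unit_group_mul.
Proof. by move=> x; apply/val_inj/mulr1. Qed.

Lemma unit_group_mulV :
  left_inverse unit_group_one unit_group_inv unit_group_mul.
Proof. by move=> x; apply/val_inj/mulVr/unit_valP. Qed.

Lemma unit_group_mulrV :
  right_inverse unit_group_one unit_group_inv unit_group_mul.
Proof. by move=> x; apply/val_inj/mulrV/unit_valP. Qed.

HB.instance Definition _ := isGroup.Build unit_group
  unit_group_mulA unit_group_mul1 unit_group_mulr1
  unit_group_mulV unit_group_mulrV.

End UnitGroup.

Definition spectrum (K : fieldType) (A : comUnitAlgType K) (f : A) : set K :=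
  [set l | l%:A - f \isn't a GRing.unit].

(* [idealr_closed] includes properness. *)
Definition maximal_ideal (A : comNzRingType) (M : {pred A}) : Prop :=
  idealr_closed M /\
  forall J : {pred A}, idealr_closed J -> {subset M <= J} -> {subset J <= M}.

Definition jacobson_radical (A : comNzRingType) : set A :=
  [set f | forall M : {pred A}, maximal_ideal M -> f \in M].
Arguments jacobson_radical A : clear implicits.

Definition semisimple (A : comNzRingType) : Prop :=
  jacobson_radical A = [set 0].

(* Main.v *)
From HB Require Import structures.
Require Import Defs.
From mathcomp Require Import all_boot all_order all_algebra.
From mathcomp Require Import ring_quotient complex.
From mathcomp Require Import all_classical all_reals all_analysis.
From mathcomp Require Import ring lra.

Set Implicit Arguments.
Unset Strict Implicit.
Unset Printing Implicit Defensive.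

Import Order.TTheory GRing.Theory Num.Theory.
Import numFieldNormedType.Exports.

Local Open Scope classical_set_scope.
Local Open Scope ring_scope.
Local Open Scope complex_scope.

Import ComplexField.Normc.
Local Notation Re := (@complex.Re _).
Local Notation Im := (@complex.Im _).

(** Write C for the complex numbers. The argument compares the characters of
    [A] with those of [B], that is, the unital algebra morphisms to C. By the
    Gelfand-Mazur theorem ([gelfand_mazur]) the kernels of characters are the
    maximal ideals, so the spectrum of an element is the set of its values at
    the characters ([spectrum_characters]), and an algebra is semisimple when
    the characters separate its points ([semisimpleP]).

    If [y] lies in the radical of [B], then [1 + y] is the image under [T] of
    a unit with spectrum reduced to 1, which is 1 because [A] is semisimple;
    hence [y = 0] and [B] is semisimple ([spectral_semisimple]). In the same
    way [T] is injective, so that [T] and its inverse play symmetric roles.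

    Let [psi] be a character of [B]. Then [phi := psi \o T] is multiplicative
    on the units of [A] and [phi x] is in the spectrum of [x]. The limit [u h]
    of [2 ^ k (phi (1 + h / 2 ^ k) - 1)] exists, is real linear in [h], and
    belongs to the spectrum of [h]. Such a functional is a character
    ([real_linear_spectral_character], after Kowalski and Slodkowski): it is
    the real part of a complex linear functional plus [i] times the imaginary
    part of another one, and both of these, as well as one suitable
    combination of them, vanish on no unit; by the Gleason-Kahane-Zelazko
    theorem, which has an elementary proof ([nonvanishing_sqr]), all three are
    multiplicative, and this forces the first two to coincide. Moreover [phi]
    equals [u] near 1, since the quotient of the two is multiplicative and
    equals 1 up to second order ([local_character]). Letting [psi] vary, [T]
    agrees with an algebra morphism [S] from [A] to [B] on all elements close
    to nonzero scalars ([spectral_morphism_extension]); the same construction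
    for the inverse of [T] gives the inverse of [S].

    It remains to see that [T] and [S] agree on every unit, which the value of
    [phi] at a single [psi] does not decide when the group of units is not
    connected. Here [U := S^-1 \o T] preserves spectra and fixes the elements
    close to nonzero scalars, and a peaking argument on the characters where
    an element has almost maximal modulus shows that [U] is the identity
    ([spectral_automorphism_rigid]). *)

(** * The modulus of a complex number as a real number *)

Section Modulus.
Variable R : realType.
Implicit Types (z w : R[i]) (x : R) (n : nat).

Lemma normr_normc z : `|z| = (normc z)%:C. Proof. by case: z. Qed.

Lemma normc_ge0 z : 0 <= normc z.
Proof. by case: z => a b; rewrite sqrtr_ge0. Qed.

Lemma normcD z w : normc (z + w) <= normc z + normc w.
Proof. exact: le_normcD. Qed.

Lemma normcB z w : normc (z - w) = normc (w - z).
Proof. by rewrite -normcN opprB. Qed.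

Lemma normc_triangle z1 z2 z3 : normc (z1 - z3) <= normc (z1 - z2) + normc (z2 - z3).
Proof.
by apply: le_trans (normcD _ _); rewrite [_ - z2 + _]addrA subrK.
Qed.

Lemma normc_lbD z w : normc z - normc w <= normc (z + w).
Proof.
rewrite lerBlDr; apply: le_trans (_ : normc (z + w) + normc (- w) <= _).
  by rewrite -{1}(addrK w z) normcD.
by rewrite normcN.
Qed.

Lemma normc_eq0 z : (normc z == 0) = (z == 0).
Proof.
by apply/eqP/eqP => [/eq0_normc//|->]; rewrite normc0.
Qed.

Lemma normc_gt0 z : (0 < normc z) = (z != 0).
Proof. by rewrite lt_def normc_eq0 normc_ge0 andbT. Qed.

Lemma normcX z n : normc (z ^+ n) = normc z ^+ n.
Proof. by elim: n => [|n IH]; rewrite ?normc1 // !exprS normcM IH. Qed.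

Lemma normc_real x : normc x%:C = `|x|.
Proof. by rewrite /= expr0n /= addr0 sqrtr_sqr. Qed.

Lemma normc_nat n : normc n%:R = n%:R :> R.
Proof. by rewrite -(rmorph_nat (real_complex R)) normc_real ger0_norm. Qed.

Lemma normc_sqrE z : normc z ^+ 2 = Re z ^+ 2 + Im z ^+ 2.
Proof. by case: z => a b; rewrite /= sqr_sqrtr // addr_ge0 ?sqr_ge0. Qed.

Lemma Re_le_normc z : `|Re z| <= normc z.
Proof.
rewrite -[leRHS]ger0_norm ?normc_ge0 // -ler_sqr ?nnegrE ?normr_ge0 //.
by rewrite !real_normK ?num_real // normc_sqrE lerDl sqr_ge0.
Qed.

Lemma Im_le_normc z : `|Im z| <= normc z.
Proof.
rewrite -[leRHS]ger0_norm ?normc_ge0 // -ler_sqr ?nnegrE ?normr_ge0 //.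
by rewrite !real_normK ?num_real // normc_sqrE lerDr sqr_ge0.
Qed.

Lemma normc_le_ReIm z : normc z <= `|Re z| + `|Im z|.
Proof.
rewrite -[leLHS]ger0_norm ?normc_ge0 // -ler_sqr ?nnegrE ?normr_ge0 ?addr_ge0 //.
rewrite real_normK ?num_real // normc_sqrE sqrrD !real_normK ?num_real //.
by rewrite addrAC lerDl mulrn_wge0 // mulr_ge0.
Qed.

Lemma normc_sum (I : Type) (s : seq I) (P : pred I) (F : I -> R[i]) :
  normc (\sum_(i <- s | P i) F i) <= \sum_(i <- s | P i) normc (F i).
Proof.
elim/big_rec2: _ => [|i x z _ IH]; first by rewrite normc0.
by rewrite (le_trans (normcD _ _)) // lerD2l.
Qed.

Lemma ReD z w : Re (z + w) = Re z + Re w. Proof. by case: z w => ? ? []. Qed.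
Lemma ImD z w : Im (z + w) = Im z + Im w. Proof. by case: z w => ? ? []. Qed.
Lemma ReN z : Re (- z) = - Re z. Proof. by case: z. Qed.
Lemma ImN z : Im (- z) = - Im z. Proof. by case: z. Qed.
Lemma ReM z w : Re (z * w) = Re z * Re w - Im z * Im w.
Proof. by case: z w => ? ? []. Qed.

Lemma complex_inj z w : Re z = Re w -> Im z = Im w -> z = w.
Proof. by case: z w => ? ? [? ?] /= -> ->. Qed.

Lemma normc_small_eq0 z : (forall e : R, 0 < e -> normc z <= e) -> z = 0.
Proof.
move=> h; apply/eq0_normc/eqP; rewrite eq_le normc_ge0 andbT.
by apply/ler_addgt0Pl => e /h; rewrite addr0.
Qed.

End Modulus.

Local Arguments normc : simpl never.

(** * Algebra norms in which the elements near 1 are invertible *)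

(** The completeness of a Banach algebra enters only through the last clause,
    so the theory below concerns any algebra with such a norm. *)
Record algebra_norm (R : realType) (A : comUnitAlgType R[i]) (N : A -> R) :
    Prop := AlgebraNorm {
  normaD : forall x y, N (x + y) <= N x + N y;
  normaM : forall x y, N (x * y) <= N x * N y;
  normaZ : forall (a : R[i]) x, N (a *: x) = normc a * N x;
  norma_unit : forall x, N x < 1 -> 1 + x \is a GRing.unit
}.

Section AlgebraNorm.
Variables (R : realType) (A : comUnitAlgType R[i]) (N : A -> R).
Hypothesis NA : algebra_norm N.
Implicit Types (x y : A) (l : R[i]).

Lemma norma0 : N 0 = 0.
Proof. by rewrite -(scale0r (0 : A)) (normaZ NA) normc0 mul0r. Qed.

Lemma normaN x : N (- x) = N x.
Proof. by rewrite -scaleN1r (normaZ NA) normcN normc1 mul1r. Qed.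

Lemma norma_ge0 x : 0 <= N x.
Proof.
have := normaD NA x (- x); rewrite subrr norma0 normaN -mulr2n.
by rewrite pmulrn_lge0.
Qed.

Lemma norma1_ge1 : 1 <= N 1.
Proof.
rewrite leNgt; apply/negP; rewrite -normaN => /(norma_unit NA).
by rewrite subrr unitr0.
Qed.

Lemma norma_unit_large l x : N x < normc l -> l%:A + x \is a GRing.unit.
Proof.
move=> h; have l0 : l != 0.
  by rewrite -normc_gt0 (le_lt_trans (norma_ge0 x)).
have -> : l%:A + x = l *: (1 + l^-1 *: x).
  by rewrite scalerDr scalerA divff // scale1r.
rewrite scaler_unit ?unitfE // (norma_unit NA) // (normaZ NA) normcV.
by rewrite mulrC ltr_pdivrMr ?normc_gt0 // mul1r.
Qed.

Lemma spectrum_bound l x : spectrum x l -> normc l <= N x.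
Proof.
rewrite /spectrum /= leNgt; apply: contraNN => h.
by rewrite norma_unit_large // normaN.
Qed.

(** Solve [(1 + x)^-1 = 1 - (1 + x)^-1 * x] for the norm of the inverse. The
    factor [N 1] is there because [N 1] may exceed 1. *)
Lemma norma_inv_le x : N x <= 2^-1 -> N (1 + x)^-1 <= 2 * N 1.
Proof.
move=> hx; have ux : 1 + x \is a GRing.unit.
  by apply: (norma_unit NA); apply: (le_lt_trans hx); lra.
have e : (1 + x)^-1 = 1 - (1 + x)^-1 * x.
  by rewrite -{2}(mulVr ux) mulrDr mulr1 addrK.
have : N (1 + x)^-1 <= N 1 + N (1 + x)^-1 * N x.
  by rewrite {1}e (le_trans (normaD NA _ _)) // lerD2l normaN (normaM NA).
have := norma_ge0 (1 + x)^-1; have := norma_ge0 x.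
move: (N _^-1) (N x) (N 1) hx => a b c; nra.
Qed.

End AlgebraNorm.

Lemma expr_small (R : realType) (r e : R) : 0 <= r < 1 -> 0 < e ->
  exists n, r ^+ n < e.
Proof.
move=> /andP[r0 r1] e0.
have /cvgrPdist_lt/(_ e e0)[n _ h] : (GRing.exp r : R ^nat) x @[x --> \oo] --> 0.
  by apply: cvg_expr; rewrite ger0_norm.
exists n; have := h n (leqnn n).
by rewrite /= sub0r normrN ger0_norm // exprn_ge0.
Qed.

(** ** The norm of a Banach algebra *)

Section Neumann.
Variables (R : realType) (A : comBanachAlgType R[i]).

Definition banach_norm (x : alg A) : R := Re (`|x : A|).

Lemma banach_normE (x : alg A) : `|x : A| = (banach_norm x)%:C.
Proof. by rewrite RRe_real // ger0_real. Qed.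

Lemma banach_normD (x y : alg A) :
  banach_norm (x + y) <= banach_norm x + banach_norm y.
Proof.
by rewrite -lecR rmorphD /= -!banach_normE; exact: (@ler_normD _ A).
Qed.

Lemma banach_normM (x y : alg A) :
  banach_norm (x * y) <= banach_norm x * banach_norm y.
Proof. by rewrite -lecR rmorphM /= -!banach_normE; exact: normr_bmul_le. Qed.

Lemma banach_normZ (a : R[i]) (x : alg A) :
  banach_norm (a *: x) = normc a * banach_norm x.
Proof.
apply: complexI; rewrite rmorphM /= -!banach_normE -normr_normc.
exact: (@normrZ _ A).
Qed.

Lemma banach_norm_eq0 (x : alg A) : banach_norm x = 0 -> x = 0.
Proof.
by move=> h; apply/eqP; rewrite -(@normr_eq0 _ A) banach_normE h.
Qed.

Lemma banach_normN (x : alg A) : banach_norm (- x) = banach_norm x.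
Proof. by rewrite -scaleN1r banach_normZ normcN normc1 mul1r. Qed.

Lemma banach_norm_ge0 (x : alg A) : 0 <= banach_norm x.
Proof. by rewrite -lecR -banach_normE; exact: (@normr_ge0 _ A). Qed.

Lemma banach_norm_cvg (s : nat -> alg A) :
  (forall e : R, 0 < e ->
     exists n, forall m, (n <= m)%N -> banach_norm (s n - s m) < e) ->
  exists L, forall e : R, 0 < e ->
     exists n, forall m, (n <= m)%N -> banach_norm (L - s m) < e.
Proof.
move=> cs; pose t : nat -> A := s.
have gt0C (e : R[i]) : 0 < e -> e = (Re e)%:C /\ 0 < Re e.
  by case: e => a b; rewrite ltcE /= => /andP[/eqP -> ->].
have ct : cvg (t x @[x --> \oo]).
  apply: cauchy_cvg; apply: cauchy_exP => e /gt0C[-> /cs[n h]].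
  exists (t n), n => // m /h hm.
  by rewrite -ball_normE /= -[X in `|X|]/(s n - s m : alg A) banach_normE ltcR.
exists (lim (t x @[x --> \oo])) => e e0.
have e0C : (0 : R[i]) < e%:C by rewrite ltcR.
have [n _ h] := (cvgrPdist_lt _ _).1 ct _ e0C.
exists n => m /h /=.
by rewrite -[X in `|X|]/(lim (t x @[x --> \oo]) - s m : alg A) banach_normE ltcR.
Qed.

(** The Neumann series of [x] is Cauchy, and its sum inverts [1 - x]. *)
Lemma neumann (x : alg A) : banach_norm x < 1 -> 1 - x \is a GRing.unit.
Proof.
set r := banach_norm x => r1.
have r0 : 0 <= r := banach_norm_ge0 x.
have r01 : 0 <= r < 1 by rewrite r0.
pose c := banach_norm 1; have c0 : 0 <= c := banach_norm_ge0 1.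
have nX n : banach_norm (x ^+ n) <= c * r ^+ n.
  elim: n => [|n IH]; first by rewrite mulr1.
  rewrite !exprS (le_trans (banach_normM _ _)) // mulrCA ler_wpM2l //.
pose s n : alg A := \sum_(k < n) x ^+ k.
have s1 n : (1 - x) * s n = 1 - x ^+ n by rewrite -[1 - x]opprB mulNr -subrX1 opprB.
have tail n j : (1 - r) * banach_norm (s n - s (n + j)%N) <=
    c * r ^+ n * (1 - r ^+ j).
  elim: j => [|j IH].
    rewrite addn0 !subrr -(scale0r (0 : alg A)) banach_normZ normc0.
    by rewrite !(mul0r, mulr0).
  have -> : s n - s (n + j.+1)%N = (s n - s (n + j)%N) - x ^+ (n + j).
    by rewrite /s addnS big_ord_recr /= opprD addrA.
  have := banach_normD (s n - s (n + j)%N) (- x ^+ (n + j)).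
  rewrite banach_normN => /(ler_wpM2l (_ : 0 <= 1 - r)) /le_trans; apply.
    by rewrite subr_ge0 ltW.
  have := ler_wpM2l (_ : 0 <= 1 - r) (nX (n + j)%N).
  rewrite subr_ge0 => /(_ (ltW r1)) hj.
  rewrite mulrDr (le_trans (lerD IH hj)) // exprD exprS.
  rewrite le_eqVlt; apply/orP; left; apply/eqP; ring.
have [e e0|L hL] := @banach_norm_cvg s.
  have d0 : 0 < e * (1 - r) / (c + 1).
    by rewrite divr_gt0 ?mulr_gt0 ?subr_gt0 ?ltr_wpDl.
  have [n hn] := expr_small r01 d0.
  exists n => m nm.
  rewrite -(subnKC nm) -(ltr_pM2l (_ : 0 < 1 - r)) ?subr_gt0 //.
  apply: le_lt_trans (tail _ _) _.
  apply: le_lt_trans (_ : (c + 1) * r ^+ n < _).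
    have := exprn_ge0 n r0; have := exprn_ge0 (m - n) r0.
    move: (r ^+ n) (r ^+ _) => u v v0 u0.
    by have := mulr_ge0 (mulr_ge0 c0 u0) v0; lra.
  by rewrite mulrC -ltr_pdivlMr ?ltr_wpDl // [_ * e]mulrC.
apply/unitrPr; exists L.
apply/eqP; rewrite -subr_eq0; apply/eqP/banach_norm_eq0/eqP.
rewrite eq_le banach_norm_ge0 andbT; apply/ler_addgt0Pl => e e0; rewrite addr0.
have e2 : 0 < e / 4 by rewrite divr_gt0.
have [n hn] := hL _ e2.
have d0 : 0 < e / (2 * (c + 1)) by rewrite divr_gt0 ?mulr_gt0 ?ltr_wpDl.
have [m hm] := expr_small r01 d0.
pose p := (n + m)%N.
have -> : (1 - x) * L - 1 = (L - s p) - x * (L - s p) - x ^+ p.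
  have /(congr1 (fun y => y - 1)) := s1 p; rewrite addrAC subrr add0r => <-; ring.
have hp := hn p (leq_addr _ _).
have hxp : banach_norm (x ^+ p) <= e / 2.
  apply: le_trans (nX _) _; rewrite /p exprD mulrCA.
  apply: le_trans (_ : 1 * (c * r ^+ m) <= _).
    by rewrite ler_wpM2r ?mulr_ge0 ?exprn_ge0 // exprn_ile1 // ltW.
  rewrite mul1r; apply: le_trans (_ : (c + 1) * (e / (2 * (c + 1))) <= _).
    by rewrite ler_pM ?exprn_ge0 ?lerDl // ltW.
  suff -> : (c + 1) * (e / (2 * (c + 1))) = e / 2 by [].
  by field; rewrite gt_eqF // ltr_wpDl.
apply: le_trans (banach_normD _ _) _; rewrite banach_normN.
have := banach_normD (L - s p) (- (x * (L - s p))); rewrite banach_normN.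
have := banach_normM x (L - s p); rewrite -/r.
have := ler_piMl (banach_norm_ge0 (L - s p)) (ltW r1); lra.
Qed.

Lemma banach_algebra_norm : algebra_norm banach_norm.
Proof.
split; [exact: banach_normD|exact: banach_normM|exact: banach_normZ|].
by move=> x x1; rewrite -[x]opprK neumann // banach_normN.
Qed.

End Neumann.

(** * The Gelfand-Mazur theorem *)

Section LogDerivative.
Variables (Q : comNzRingType) (y : Q).

(** The sum of the inverses of the linear factors is the logarithmic
    derivative of the product. *)
Lemma horner_deriv_prod (I : Type) (a R : I -> Q) (s : seq I) :
  (forall i, R i * (y - a i) = 1) ->
  (\prod_(i <- s) ('X - (a i)%:P)).[y] * \sum_(i <- s) R i
    = (\prod_(i <- s) ('X - (a i)%:P))^`().[y].
Proof.
move=> Ra; elim: s => [|i s IH].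
  by rewrite !big_nil -polyC1 derivC horner0 mulr0.
rewrite !big_cons derivM derivXsubC mul1r hornerD !hornerM hornerXsubC -IH.
rewrite mulrDr mulrAC [_ * R i]mulrC Ra mul1r.
by rewrite !mulrA.
Qed.

Lemma horner_prod_inv (I : Type) (a R : I -> Q) (s : seq I) :
  (forall i, R i * (y - a i) = 1) ->
  (\prod_(i <- s) R i) * (\prod_(i <- s) ('X - (a i)%:P)).[y] = 1.
Proof.
move=> Ra; elim: s => [|i s IH]; first by rewrite !big_nil mul1r hornerC.
by rewrite !big_cons hornerM hornerXsubC mulrACA IH mulr1 Ra.
Qed.

End LogDerivative.

Section GelfandMazur.
Variables (R : realType) (Q : comNzRingType) (iota : {rmorphism R[i] -> Q}).
Variable q : Q -> R.
Hypothesis qD : forall u v, q (u + v) <= q u + q v.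
Hypothesis qM : forall u v, q (u * v) <= q u * q v.
Hypothesis qZ : forall a u, q (iota a * u) = normc a * q u.
Hypothesis q1 : 0 < q 1.
Variable x : Q.
Implicit Types (l r : R[i]) (n : nat).

Let q0 : q 0 = 0.
Proof. by rewrite -(mul0r 0) -(rmorph0 iota) qZ normc0 mul0r. Qed.

Let qN u : q (- u) = q u.
Proof. by rewrite -mulN1r -(rmorph1 iota) -rmorphN qZ normcN normc1 mul1r. Qed.

Let q_ge0 u : 0 <= q u.
Proof. by have := qD u (- u); rewrite subrr q0 qN -mulr2n pmulrn_lge0. Qed.

Let qMn u n : q (u *+ n) = q u *+ n.
Proof. by rewrite -mulr_natl -(rmorph_nat iota) qZ normc_nat mulr_natl. Qed.

Let qX u n : (0 < n)%N -> q (u ^+ n) <= q u ^+ n.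
Proof.
elim: n => [//|[|n] IH _]; first by rewrite !expr1.
by rewrite ![_ ^+ n.+2]exprS (le_trans (qM _ _)) // ler_wpM2l ?IH.
Qed.

Let q_sum (I : Type) (s : seq I) (F : I -> Q) :
  q (\sum_(i <- s) F i) <= \sum_(i <- s) q (F i).
Proof.
elim: s => [|i s IH]; first by rewrite !big_nil q0.
by rewrite !big_cons (le_trans (qD _ _)) // lerD2l.
Qed.

Section Resolvent.
Variable res : R[i] -> Q.
Hypothesis resK : forall l, res l * (x - iota l) = 1.

Lemma resolvent_gt0 l : 0 < q (res l).
Proof.
rewrite lt_def q_ge0 andbT; apply: contraTneq q1 => h.
by rewrite -leNgt -(resK l) (le_trans (qM _ _)) // h mul0r.
Qed.

Lemma resolventB l m : res l - res m = iota (l - m) * (res l * res m).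
Proof.
have -> : res l - res m = res l * res m * ((x - iota m) - (x - iota l)).
  rewrite mulrBr -mulrA resK mulr1 [res l * _]mulrC -mulrA resK mulr1 //.
rewrite mulrC; congr (_ * _); rewrite rmorphB; ring.
Qed.

Lemma resolvent_lip l m : `|q (res l) - q (res m)| <=
  normc (l - m) * (q (res l) * q (res m)).
Proof.
have h l1 m1 : q (res l1) - q (res m1) <= normc (l1 - m1) * (q (res l1) * q (res m1)).
  rewrite lerBlDr -{1}(subrK (res m1) (res l1)) (le_trans (qD _ _)) // lerD2r.
  by rewrite resolventB qZ ler_wpM2l ?normc_ge0 ?qM.
by rewrite ler_norml lerNl opprB h andbT [leRHS]mulrC [q (res l) * _]mulrC
  mulrC normcB h.
Qed.

Lemma resolvent_infty l : q (res l) * (normc l - q x) <= q 1.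
Proof.
have e : iota l * res l = res l * x - 1 by rewrite -(resK l); ring.
have : q (iota l * res l) <= q (res l) * q x + q 1.
  by rewrite e (le_trans (qD _ _)) // qN lerD2r qM.
by rewrite qZ; lra.
Qed.

(** The norm of the resolvent is continuous and tends to 0 at infinity. *)
Lemma resolvent_max : exists l0, forall l, q (res l) <= q (res l0).
Proof.
pose h (p : R * R) := q (res (p.1 +i* p.2)).
have hc : continuous h.
  move=> p; apply/cvgrPdist_lt => e e0.
  pose m := q (res (p.1 +i* p.2)).
  have m0 : 0 < m := resolvent_gt0 _.
  pose d := Num.min (4^-1 / m) (e / (8 * m ^+ 2)).
  have d0 : 0 < d.
    by rewrite lt_min !divr_gt0 ?mulr_gt0 ?exprn_gt0.
  apply: filterS (nbhsx_ballx (p : R * R) d d0) => p' [pp1 pp2].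
  have dn : normc ((p.1 +i* p.2) - (p'.1 +i* p'.2)) < 2 * d.
    apply: le_lt_trans (normc_le_ReIm _) _.
    by rewrite /= mulr_natl mulr2n ltrD.
  have := resolvent_lip (p.1 +i* p.2) (p'.1 +i* p'.2).
  rewrite -/m /h -/m; set m' := q (res (p'.1 +i* p'.2)).
  have m'0 : 0 < m' := resolvent_gt0 _.
  move: (normc _) dn (normc_ge0 (p.1 +i* p.2 - (p'.1 +i* p'.2))) => t dt t0 hm.
  have d1 : 4 * d * m <= 1.
    have : d <= 4^-1 / m by rewrite /d ge_min lexx.
    by rewrite ler_pdivlMr // -mulrA; lra.
  have d2 : 8 * d * m ^+ 2 <= e.
    have : d <= e / (8 * m ^+ 2) by rewrite /d ge_min lexx orbT.
    by rewrite ler_pdivlMr ?mulr_gt0 ?exprn_gt0 //; lra.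
  have tm : 2 * (t * m) <= 1.
    have : t * m <= 2 * d * m by rewrite ler_wpM2r ?ltW. by lra.
  have m'm : m' <= 2 * m.
    move: hm; rewrite ler_norml => /andP[hm _].
    have : t * (m * m') <= 2^-1 * m' by rewrite mulrA; apply: ler_wpM2r; [exact: ltW|lra].
    by lra.
  apply: le_lt_trans hm _; apply: le_lt_trans (_ : t * (2 * m ^+ 2) < _).
    by rewrite ler_wpM2l // expr2 mulrCA ler_wpM2l // ltW.
  apply: lt_le_trans d2.
  have : t * m ^+ 2 < 2 * d * m ^+ 2 by rewrite ltr_pM2r // exprn_gt0.
  have : 0 < d * m ^+ 2 by rewrite mulr_gt0 ?exprn_gt0.
  by lra.
pose K := q x + q 1 / q (res 0).
have K0 : 0 <= K by rewrite addr_ge0 ?divr_ge0.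
have cK := compact_setX (@segment_compact R (- K) K) (@segment_compact R (- K) K).
have [|c cin cmax] := compact_EVT_max _ cK (continuous_subspaceT hc).
  by exists (0, 0); split; rewrite /= in_itv /= oppr_le0 K0.
exists (c.1 +i* c.2) => -[a b].
have [|ab] := boolP ((a, b) \in `[- K, K]%classic `*` `[- K, K]%classic).
  exact: cmax.
have zin : (0, 0) \in `[- K, K]%classic `*` `[- K, K]%classic.
  by apply/mem_set; split; rewrite /= in_itv /= oppr_le0 K0.
apply: le_trans (cmax _ zin).
have nK : K < normc (a +i* b).
  rewrite ltNge; apply: contra ab => hab; apply/mem_set; split; rewrite /= in_itv /=.
    by rewrite -ler_norml (le_trans (Re_le_normc (a +i* b))).
  by rewrite -ler_norml (le_trans (Im_le_normc (a +i* b))).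
rewrite /h /= -[0 +i* 0]/(0 : R[i]); have := resolvent_infty (a +i* b).
have := resolvent_gt0 0; have := resolvent_gt0 (a +i* b).
move: (normc _) nK => t; rewrite /K.
move: (q (res (a +i* b))) (q (res 0)) => u v nK u0 v0 huv.
rewrite -(ler_pM2r (_ : 0 < t - q x)); last first.
  by rewrite subr_gt0 (le_lt_trans _ nK) // lerDl divr_ge0 // ltW.
apply: le_trans huv _; rewrite -ler_pdivrMl // mulrC.
by move: nK; lra.
Qed.

(** Take for points the [n]-th roots of [r ^+ n], shifted by [l0]: the sum of
    the resolvents there is a logarithmic derivative, computed explicitly.
    Thus the resolvent at the center of a circle is, up to an error decaying
    geometrically in [n], the mean of its values at [n] points of the circle,
    one of them being [l0 + r]. If its norm is maximal at the center, the other
    [n - 1] values cannot make up for a smaller value at [l0 + r] once [n] is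
    large. *)
Lemma resolvent_mean l0 r :
  (forall l, q (res l) <= q (res l0)) -> 4 * normc r * q (res l0) <= 1 ->
  q (res l0) <= q (res (l0 + r)).
Proof.
set v := res l0 => vmax hr.
pose y := x - iota l0; have vy : v * y = 1 by exact: resK.
pose rho := normc r * q v.
have rho0 : 0 <= rho by rewrite mulr_ge0 ?normc_ge0.
have rho4 : 4 * rho <= 1 by rewrite /rho mulrA.
have main n : (0 < n)%N ->
    q v <= q (res (l0 + r)) + 2 * q v * q 1 * 2^-1 ^+ n.
  move=> n0; pose p : {poly R[i]} := 'X^n - (r ^+ n)%:P.
  have lp : lead_coef p = 1 by rewrite lead_coefXnsubC.
  have [s] := closed_field_poly_normal p; rewrite lp scale1r => ps.
  have szs : size s = n.
    by apply: succn_inj; rewrite -(size_prod_XsubC s id) -ps size_XnsubC.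
  have rs : r \in s.
    by rewrite -root_prod_XsubC -ps rootE !hornerE subrr.
  pose Y := \prod_(z <- s) res (l0 + z).
  have Rz z : res (l0 + z) * (y - iota z) = 1.
    by rewrite /y -addrA -opprD -rmorphD resK.
  have pQ : \prod_(z <- s) ('X - (iota z)%:P) = 'X^n - (iota (r ^+ n))%:P.
    have := congr1 (map_poly iota) ps.
    rewrite rmorphB /= map_polyXn map_polyC /= rmorph_prod /= => ->.
    by apply: eq_bigr => z _; rewrite rmorphB /= map_polyX map_polyC.
  have YP : Y * (y ^+ n - iota (r ^+ n)) = 1.
    by have := horner_prod_inv s Rz; rewrite pQ !hornerE.
  have SP : (y ^+ n - iota (r ^+ n)) * (\sum_(z <- s) res (l0 + z)) = y ^+ n.-1 *+ n.
    have := horner_deriv_prod s Rz; rewrite pQ !hornerE => ->.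
    by rewrite derivB derivC subr0 derivXn hornerMn hornerXn.
  (* [W] is the error term: the mean of the resolvents is [v * (1 + W)]. *)
  pose W := iota (r ^+ n) * Y.
  have yY : y ^+ n * Y = 1 + W.
    by rewrite /W -YP; ring.
  have WE : W = iota (r ^+ n) * (v ^+ n * (1 + W)).
    by rewrite -yY !mulrA -[_ * v ^+ n * _]mulrA -exprMn vy expr1n mulr1.
  have SE : \sum_(z <- s) res (l0 + z) = (v + v * W) *+ n.
    have -> : v + v * W = Y * y ^+ n.-1.
      rewrite -{1}[v]mulr1 -mulrDr -yY -{1}(prednK n0) exprS !mulrA vy mul1r.
      by rewrite mulrC.
    by rewrite -mulrnAr -SP mulrA YP mul1r.
  have rn : rho ^+ n <= 4^-1 ^+ n.
    by rewrite lerXn2r ?nnegrE //; lra.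
  have r4 : (4^-1 : R) ^+ n <= 4^-1.
    by rewrite -[leRHS]expr1 ler_wiXn2l // ?invr_ge0 // invf_le1 // ler1n.
  have qW : q W <= 2 * q 1 * rho ^+ n.
    have : q W <= rho ^+ n * (q 1 + q W).
      rewrite {1}WE qZ normcX /rho exprMn -mulrA ler_wpM2l ?exprn_ge0 ?normc_ge0 //.
      by rewrite (le_trans (qM _ _)) // ler_pM ?qX ?qD.
    have := q_ge0 W; have := ltW q1; have : 0 <= rho ^+ n by rewrite exprn_ge0.
    move: (rho ^+ n) rn (q W) (q 1) => a ra b c; nra.
  have qS : q (\sum_(z <- s) res (l0 + z)) <= q (res (l0 + r)) + q v *+ n.-1.
    rewrite (big_rem r) //= (le_trans (qD _ _)) // lerD2l.
    apply: le_trans (q_sum _ _) _.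
    have -> : n.-1 = size (rem r s) by rewrite size_rem // szs.
    elim: (rem r s) => [|z s' IH]; first by rewrite big_nil.
    by rewrite big_cons mulrS lerD.
  have qSn : q v *+ n - (q v * q W) *+ n <= q (\sum_(z <- s) res (l0 + z)).
    rewrite SE qMn -mulrnBl lerMn2r; apply/orP; right.
    have := qD (v + v * W) (- (v * W)); rewrite addrK qN => h.
    rewrite lerBlDr (le_trans h) // lerD2l; exact: qM.
  have nn : n%:R * (4^-1 : R) ^+ n <= 2^-1 ^+ n.
    have -> : (4^-1 : R) = 2^-1 * 2^-1 by lra.
    rewrite exprMn mulrA -[leRHS]mul1r ler_wpM2r ?exprn_ge0 // exprVn.
    by rewrite ler_pdivrMr ?exprn_gt0 // mul1r -natrX ler_nat ltnW // ltn_expl.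
  have : (q v * q W) *+ n <= 2 * q v * q 1 * 2^-1 ^+ n.
    rewrite -mulr_natl.
    apply: le_trans (_ : n%:R * (q v * (2 * q 1 * 4^-1 ^+ n)) <= _).
      rewrite ler_wpM2l // ler_wpM2l // (le_trans qW) // ler_wpM2l //.
      by rewrite mulr_ge0 // ltW.
    have := ler_wpM2l (_ : 0 <= 2 * q v * q 1) nn.
    have c0 : 0 <= 2 * q v * q 1 by rewrite !mulr_ge0.
    move=> /(_ c0) h; apply: le_trans h.
    rewrite le_eqVlt; apply/orP; left; apply/eqP; ring.
  move: qS qSn; rewrite -{2}(prednK n0) mulrS; lra.
apply/ler_addgt0Pl => e e0.
have d0 : 0 < e / (2 * q v * q 1) by rewrite divr_gt0 ?mulr_gt0 ?resolvent_gt0.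
have h2 : 0 <= (2^-1 : R) < 1 by lra.
have [n hn] := expr_small h2 d0.
rewrite (le_trans (main n.+1 _)) // addrC lerD2r.
move: hn; rewrite ltr_pdivlMr ?mulr_gt0 ?resolvent_gt0 // => /ltW hn.
apply: le_trans hn; rewrite mulrC exprS.
have : 0 <= 2^-1 ^+ n * (2 * q v * q 1) by rewrite !mulr_ge0 // exprn_ge0.
by lra.
Qed.

End Resolvent.

(** If every [x - iota l] were invertible, [resolvent_mean] would propagate the
    maximum of the norm of the resolvent by steps of a fixed length up to
    infinity, where the resolvent tends to 0. *)
Lemma gelfand_mazur : exists l, forall u, u * (x - iota l) <> 1.
Proof.
apply: contrapT => /forallNP h.
have {}h l : exists u, u * (x - iota l) = 1.
  by have /existsNP[u /contrapT] := h l; exists u.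
pose res l := xget 0 [set u | u * (x - iota l) = 1].
have resK l : res l * (x - iota l) = 1.
  by have [u] := h l; rewrite /res; case: xgetP => [//|/(_ u)].
have [l0 lmax] := resolvent_max resK.
set m := q (res l0) in lmax; have m0 : 0 < m := resolvent_gt0 resK l0.
pose r : R[i] := (4^-1 / m)%:C.
have r0 : 0 < 4^-1 / m by rewrite divr_gt0.
have nr : normc r = 4^-1 / m by rewrite normc_real ger0_norm // ltW.
have cst k : q (res (l0 + r *+ k)) = m.
  elim: k => [|k IH]; first by rewrite addr0.
  apply/eqP; rewrite eq_le lmax -[m]IH mulrSr addrA.
  apply: (resolvent_mean resK) => [l|]; first by rewrite IH.
  by rewrite IH nr -mulrA mulfVK ?gt_eqF //; lra.
pose K := normc l0 + q x + q 1 / m + 1.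
pose k := Num.truncn (K / (4^-1 / m)).
have hk : K < (4^-1 / m) * k.+1%:R.
  by rewrite -ltr_pdivrMl // mulrC truncnS_gt.
have := resolvent_infty resK (l0 + r *+ k.+1); rewrite cst.
have : normc (r *+ k.+1) - normc l0 <= normc (l0 + r *+ k.+1).
  by rewrite [l0 + _]addrC; exact: normc_lbD.
rewrite normcMn nr -(mulr_natr (4^-1 / m)).
move: hk; rewrite /K; move: (normc (_ + _)) (normc l0) => c c0 hk hc hm.
have : q 1 / m < c - q x by move: (_ * k.+1%:R) hk hc => t; lra.
by rewrite ltr_pdivrMr // mulrC ltNge hm.
Qed.

End GelfandMazur.

(** * Characters and maximal ideals *)

Local Notation character A := {lrmorphism A -> (_)[i] | *%R}.

Section Pack.
Variables (K : fieldType) (A B : comUnitAlgType K).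

Lemma lrmorphism_exists (f : A -> B) : f 1 = 1 -> {morph f : x y / x + y} ->
  {morph f : x y / x * y} -> (forall a x, f (a *: x) = a *: f x) ->
  exists F : {lrmorphism A -> B}, F =1 f.
Proof.
move=> f1 fD fM fZ.
have f0 : f 0 = 0 by apply: (addrI (f 0)); rewrite -fD !addr0.
have fB : additive f.
  move=> x y; rewrite fD; congr (_ + _).
  by apply: (addrI (f y)); rewrite -fD !subrr f0.
have fM1 : multiplicative f by split.
pose H : {lrmorphism A -> B} := HB.pack f (GRing.isAdditive.Build A B f fB)
  (GRing.isMultiplicative.Build A B f fM1) (GRing.isScalable.Build K A B *:%R f fZ).
by exists H.
Qed.

Lemma character_exists (f : A -> K) : f 1 = 1 -> {morph f : x y / x + y} ->
  {morph f : x y / x * y} -> (forall a x, f (a *: x) = a * f x) ->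
  exists F : {lrmorphism A -> K | *%R}, F =1 f.
Proof.
move=> f1 fD fM fZ.
have f0 : f 0 = 0 by apply: (addrI (f 0)); rewrite -fD !addr0.
have fB : additive f.
  move=> x y; rewrite fD; congr (_ + _).
  by apply: (addrI (f y)); rewrite -fD !subrr f0.
have fM1 : multiplicative f by split.
pose H : {lrmorphism A -> K | *%R} := HB.pack f (GRing.isAdditive.Build A K f fB)
  (GRing.isMultiplicative.Build A K f fM1) (GRing.isScalable.Build K A K *%R f fZ).
by exists H.
Qed.

End Pack.

Lemma character_scalar (K : fieldType) (A : comUnitAlgType K)
  (chi : {lrmorphism A -> K | *%R}) l : chi (l%:A) = l.
Proof. by rewrite linearZ /= rmorph1 mulr1. Qed.

Lemma maximal_ideal_exists (A : comUnitRingType) (x : A) :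
  x \isn't a GRing.unit -> exists2 M : {pred A}, maximal_ideal M & x \in M.
Proof.
move=> nux.
pose ideal (I : set A) := [/\ I 0, ~ I 1, I x &
  forall a u v, I u -> I v -> I (a * u + v)].
(* The empty set is let in so that the union of the empty chain qualifies. *)
pose P (I : set A) := I = set0 \/ ideal I.
have [F FP Ftot|S [[S0|[S0 S1 Sx SD]] Smax]] := @Zorn_bigcup A P.
- have [E|] := pselect (exists2 I, F I & ideal I); last first.
    move=> nE; left; rewrite -subset0 => y [I FI Iy].
    have [I0|iI] := FP _ FI; first by rewrite I0 in Iy.
    by case: nE; exists I.
  right; have [I FI [I0 I1 Ix ID]] := E; split; [by exists I|..].
  + move=> [J FJ J1]; have [J0|[]//] := FP _ FJ; by rewrite J0 in J1.
  + by exists I.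
  + move=> a u v [J FJ Ju] [L FL Lv].
    have [J0|[_ _ _ JD]] := FP _ FJ; first by rewrite J0 in Ju.
    have [L0|[_ _ _ LD]] := FP _ FL; first by rewrite L0 in Lv.
    have [JL|LJ] := Ftot _ _ FJ FL.
      by exists L => //; apply: LD => //; exact: JL.
    by exists J => //; apply: JD => //; exact: LJ.
- exfalso; pose X := [set y : A | exists a, y = a * x].
  apply: (Smax X); last first.
    right; split; [by exists 0; rewrite mul0r| |by exists 1; rewrite mul1r|].
      by move=> [a e]; case/negP: nux; apply/unitrPr; exists a; rewrite mulrC.
    by move=> a _ _ [b ->] [c ->]; exists (a * b + c); rewrite mulrDl mulrA.
  rewrite S0; split; first by [].
  by move=> /(_ x) /=; apply; exists 1; rewrite mul1r.
- pose M : {pred A} := fun y => `[< S y >].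
  have MP y : reflect (S y) (y \in M) by exact: asboolP.
  exists M; last exact/MP.
  split.
    split; [exact/MP|exact/MP|].
    by move=> a u v /MP Su /MP Sv; apply/MP; exact: SD.
  move=> J [J0 J1 JD] SJ y yJ; apply/MP; apply: contrapT => yS.
  apply: (Smax [set z | z \in J]).
    split=> [z Sz|]; first exact/SJ/MP.
    by move=> /(_ y yJ).
  by right; split; [|exact/negP|exact/SJ/MP|move=> a u v uJ vJ; exact: JD].
Qed.

Lemma maximal_ideal_inv (A : comNzRingType) (M : {pred A}) (x : A) :
  maximal_ideal M -> x \notin M -> exists a, a * x - 1 \in M.
Proof.
move=> [[M0 M1 MD] Mmax] xM; apply: contrapT => nE.
pose J : {pred A} := fun y => `[< exists a m, m \in M /\ y = a * x + m >].
have JP y : reflect (exists a m, m \in M /\ y = a * x + m) (y \in J) by exact: asboolP.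
case/negP: xM; apply: (Mmax J); last first.
- by apply/JP; exists 1, 0; rewrite mul1r addr0.
- by move=> m mM; apply/JP; exists 0, m; rewrite mul0r add0r.
split.
- by apply/JP; exists 0, 0; rewrite mul0r add0r.
- apply/JP => -[a [m [mM e]]]; apply: nE; exists a.
  have -> : a * x - 1 = -1 * m + 0 by rewrite mulN1r addr0 e; ring.
  exact: MD.
- move=> a _ _ /JP[b [m [mM ->]]] /JP[c [n [nM ->]]].
  apply/JP; exists (a * b + c), (a * m + n); split; first exact: MD.
  by ring.
Qed.

Section Gelfand.
Variables (R : realType) (A : comUnitAlgType R[i]) (N : A -> R).
Hypothesis NA : algebra_norm N.

Section QuotientNorm.
Variable I : idealr A.
Local Notation Q := {ideal_quot I}.
Local Notation pi := (\pi_Q%qT).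

Definition quotient_norm (z : Q) : R := inf [set N a | a in [set a | pi a = z]].

Let has_infQ z : has_inf [set N a | a in [set a | pi a = z]].
Proof.
split; first by exists (N (repr z)), (repr z) => //=; rewrite reprK.
by exists 0 => _ [a _ <-]; exact: norma_ge0 NA a.
Qed.

Lemma quotient_norm_le a : quotient_norm (pi a) <= N a.
Proof. by apply: inf_lbound; [case: (has_infQ (pi a))|exists a]. Qed.

Lemma quotient_norm_adherent z (e : R) : 0 < e ->
  exists2 a, pi a = z & N a < quotient_norm z + e.
Proof.
by move=> e0; have [_ [a az <-] h] := inf_adherent e0 (has_infQ z); exists a.
Qed.

Lemma quotient_norm_ge0 z : 0 <= quotient_norm z.
Proof.
apply: lb_le_inf; first by case: (has_infQ z).
by move=> _ [a _ <-]; exact: norma_ge0 NA a.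
Qed.

Lemma quotient_normD u v : quotient_norm (u + v) <= quotient_norm u + quotient_norm v.
Proof.
apply/ler_addgt0Pl => e e0; have e2 : 0 < e / 2 by rewrite divr_gt0.
have [a au ha] := quotient_norm_adherent u e2.
have [b bv hb] := quotient_norm_adherent v e2.
rewrite -{1}au -{1}bv -rmorphD (le_trans (quotient_norm_le _)) //.
by have := normaD NA a b; lra.
Qed.

Lemma quotient_normM u v : quotient_norm (u * v) <= quotient_norm u * quotient_norm v.
Proof.
apply/ler_addgt0Pl => e e0.
set p := quotient_norm u; set q := quotient_norm v.
have p0 : 0 <= p := quotient_norm_ge0 u.
have q0 : 0 <= q := quotient_norm_ge0 v.
pose d := Num.min 1 (e / (p + q + 1)).
have pq : 0 < p + q + 1 by lra.
have d0 : 0 < d by rewrite lt_min ltr01 divr_gt0.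
have d1 : d <= 1 by rewrite /d ge_min lexx.
have de : d * (p + q + 1) <= e.
  by rewrite -ler_pdivlMr // /d ge_min lexx orbT.
have [a au] := quotient_norm_adherent u d0; rewrite -/p => ha.
have [b bv] := quotient_norm_adherent v d0; rewrite -/q => hb.
rewrite -{1}au -{1}bv -rmorphM (le_trans (quotient_norm_le _)) //.
apply: le_trans (normaM NA a b) _.
apply: le_trans (_ : (p + d) * (q + d) <= _).
  by apply: ler_pM; rewrite ?(norma_ge0 NA) ?ltW.
have : d * d <= d by rewrite ler_piMl // ltW.
by move: de; rewrite !mulrDr !mulrDl !mulr1 [d * p]mulrC; lra.
Qed.

Lemma quotient_normZ_le l u : quotient_norm (pi (l%:A) * u) <= normc l * quotient_norm u.
Proof.
apply/ler_addgt0Pl => e e0.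
have d0 : 0 < e / (normc l + 1) by rewrite divr_gt0 // ltr_wpDl ?normc_ge0.
have [a au ha] := quotient_norm_adherent u d0.
rewrite -{1}au -rmorphM (le_trans (quotient_norm_le _)) //.
rewrite mulr_algl (normaZ NA).
have l0 := normc_ge0 l.
apply: le_trans (_ : normc l * (quotient_norm u + e / (normc l + 1)) <= _).
  by rewrite ler_wpM2l // ltW.
rewrite mulrDr addrC lerD2r mulrA ler_pdivrMr ?ltr_wpDl //.
by rewrite mulrDr mulr1 [e * _]mulrC lerDl ltW.
Qed.

Lemma quotient_normZ l u : quotient_norm (pi (l%:A) * u) = normc l * quotient_norm u.
Proof.
apply/eqP; rewrite eq_le quotient_normZ_le /=.
have [->|l0] := eqVneq l 0; first by rewrite normc0 mul0r quotient_norm_ge0.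
rewrite -ler_pdivlMl ?normc_gt0 // -normcV.
apply: le_trans _ (quotient_normZ_le _ _); rewrite mulrA -rmorphM.
by rewrite mulr_algl scalerA mulVf // scale1r rmorph1 mul1r.
Qed.

(** A representative [a] of 1 with [N a < 1] would make [1 - a] a unit of the
    ideal. *)
Lemma quotient_norm1 : 0 < quotient_norm 1.
Proof.
apply: (@lt_le_trans _ _ 1) => //.
apply: lb_le_inf; first by case: (has_infQ 1).
move=> _ [a /= a1 <-]; rewrite leNgt; apply/negP => Na.
have : 1 - a \in I.
  by rewrite Quotient.idealrBE; apply/eqP; rewrite a1 rmorph1.
have u : 1 - a \is a GRing.unit by rewrite (norma_unit NA) // (normaN NA).
by move=> /(idealMr (1 - a)^-1); rewrite mulVr // idealr1.
Qed.

End QuotientNorm.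

(** The residue field of a maximal ideal is C: otherwise every [x - l%:A] would
    be invertible modulo [M], against the Gelfand-Mazur theorem. *)
Lemma maximal_ideal_residue (M : {pred A}) (x : A) : maximal_ideal M ->
  exists l : R[i], x - l%:A \in M.
Proof.
move=> Mmax; have Mcl := Mmax.1.
pose I : idealr A := HB.pack (M : A -> bool) (isIdealr.Build A M Mcl).
pose Q := {ideal_quot I}.
pose iota : {rmorphism R[i] -> Q} := (\pi_Q%qT \o GRing.in_alg A).
have [||||l hl] := @gelfand_mazur R Q iota (@quotient_norm I) _ _ _ _ (\pi_Q%qT x).
- exact: quotient_normD.
- exact: quotient_normM.
- exact: quotient_normZ.
- exact: quotient_norm1.
exists l; apply: contrapT => /negP /(maximal_ideal_inv Mmax)[a ha].
apply: (hl (\pi_Q%qT a)); rewrite /iota /= -rmorphB -rmorphM -(rmorph1 \pi_Q%qT).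
by apply/eqP; rewrite -Quotient.idealrBE.
Qed.

Lemma maximal_ideal_character (M : {pred A}) : maximal_ideal M ->
  exists chi : character A, forall x, chi x = 0 <-> x \in M.
Proof.
move=> Mmax; have [[M0 M1 MD] _] := Mmax.
have MM a u : u \in M -> a * u \in M.
  by move=> uM; rewrite -[_ * _]addr0 MD.
have MA u v : u \in M -> v \in M -> u + v \in M.
  by move=> uM vM; rewrite -[u]mul1r MD.
pose f x := xget (0 : R[i]) [set l | x - l%:A \in M].
have fP x : x - (f x)%:A \in M.
  have [l hl] := maximal_ideal_residue x Mmax.
  by rewrite /f; case: xgetP => [//|/(_ l)].
have funiq x l : x - l%:A \in M -> f x = l.
  move=> hl; apply/eqP; rewrite -subr_eq0; apply: contraNT M1 => fl.
  have : (l - f x)%:A \in M.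
    have := MA _ _ (MM (-1) _ hl) (fP x); congr (_ \in M).
    by rewrite scalerBl; ring.
  move=> /(MM (l - f x)^-1%:A); rewrite mulr_algl scalerA mulVf ?scale1r ?M1 //.
  by rewrite -oppr_eq0 opprB.
have [||||chi chiE] := @character_exists _ A f.
- by apply: funiq; rewrite scale1r subrr.
- move=> x y; apply: funiq; have := MA _ _ (fP x) (fP y).
  by congr (_ \in M); rewrite scalerDl; ring.
- move=> x y; apply: funiq.
  have := MA _ _ (MM x _ (fP y)) (MM (f y)%:A _ (fP x)).
  congr (_ \in M).
  have -> : (f x * f y)%:A = (f x)%:A * (f y)%:A :> A by rewrite mulr_algl scalerA.
  by ring.
- move=> a x; apply: funiq; have := MM a%:A _ (fP x); congr (_ \in M).
  by rewrite mulr_algl scalerBr scalerA.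
exists chi => x; rewrite chiE; split=> [fx|xM].
  by have := fP x; rewrite fx scale0r subr0.
by apply: funiq; rewrite scale0r subr0.
Qed.

Lemma character_ker_maximal (chi : character A) :
  maximal_ideal [pred x | chi x == 0].
Proof.
split.
  split; rewrite ?inE ?raddf0 ?rmorph1 ?oner_eq0 //.
  by move=> a u v; rewrite !inE => /eqP u0 /eqP v0; rewrite rmorphD rmorphM /= u0 v0 mulr0 addr0.
move=> J [J0 J1 JD] kJ x xJ; rewrite inE; apply: contraNT J1 => cx.
have h : x - (chi x)%:A \in J.
  by apply: kJ; rewrite inE rmorphB /= character_scalar subrr.
have := JD (-1) _ _ h xJ; rewrite mulN1r opprB subrK => {}h.
have := JD (chi x)^-1%:A _ _ h J0; rewrite addr0 mulr_algl scalerA mulVf //.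
by rewrite scale1r.
Qed.

Lemma unit_characters (x : A) :
  x \is a GRing.unit <-> forall chi : character A, chi x != 0.
Proof.
split=> [ux chi|h].
  by have := rmorph_unit chi ux; rewrite unitfE.
apply: contrapT => /negP /maximal_ideal_exists[M Mmax xM].
have [chi hchi] := maximal_ideal_character Mmax.
by have /hchi/eqP := xM; apply/negP.
Qed.

Lemma spectrum_characters (x : A) l :
  spectrum x l <-> exists chi : character A, chi x = l.
Proof.
rewrite /spectrum /=; split=> [nu|[chi <-]].
  apply: contrapT => /forallNP h; case/negP: nu; apply/unit_characters => chi.
  by rewrite rmorphB /= character_scalar subr_eq0 eq_sym; apply/eqP/h.
apply/negP => /unit_characters/(_ chi); rewrite rmorphB /= character_scalar.
by rewrite subrr eqxx.
Qed.

Lemma character_bound (chi : character A) x : normc (chi x) <= N x.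
Proof. by apply: (spectrum_bound NA); apply/spectrum_characters; exists chi. Qed.

Lemma semisimpleP : semisimple A <->
  (forall x : A, (forall chi : character A, chi x = 0) -> x = 0).
Proof.
split=> [ss x h|h].
  have : jacobson_radical A x.
    move=> M /maximal_ideal_character[chi hchi]; exact/hchi.
  by rewrite ss.
apply/seteqP; split=> [x xr|_ -> M [[]]//]; apply: h => chi.
by have := xr _ (character_ker_maximal chi); rewrite inE => /eqP.
Qed.

End Gelfand.

(** * Linear functionals that do not vanish on units *)

Section GleasonKahaneZelazko.
Variables (R : realType).

(** The degree of the polynomials met below may drop; normalizing the constant
    coefficient instead of the leading one, this only loses some factors. *)
Lemma poly_normal_rev (p : {poly R[i]}) : p`_0 = 1 ->
  exists s : seq R[i], [/\ p = \prod_(z <- s) (1 - z *: 'X),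
    size s = (size p).-1 & forall z, z \in s -> z != 0 /\ p.[z^-1] = 0].
Proof.
move=> p0; have pn0 : p != 0.
  by apply: contra_eq_neq p0 => ->; rewrite coef0 eq_sym oner_neq0.
have [r pr] := closed_field_poly_normal p.
have l0 : lead_coef p != 0 by rewrite lead_coef_eq0.
have szr : size r = (size p).-1.
  by rewrite {1}pr size_scale // size_prod_XsubC.
have rootr z : (z \in r) = (p.[z] == 0).
  by rewrite -root_prod_XsubC -(rootZ _ _ l0) -pr.
have rn0 z : z \in r -> z != 0.
  rewrite rootr; apply: contraTneq => ->.
  by rewrite horner_coef0 p0 oner_neq0.
pose c := lead_coef p * \prod_(z <- r) (- z).
have pc : p = c *: \prod_(z <- r) (1 - z^-1 *: 'X).
  rewrite {1}pr /c -scalerA; congr (_ *: _).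
  rewrite -mul_polyC rmorph_prod -big_split /=; apply: eq_big_seq => z /rn0 z0.
  rewrite mul_polyC scalerBr scalerA mulNr divff // scaleN1r opprK alg_polyC.
  by rewrite rmorphN addrC.
have c1 : c = 1.
  have := p0; rewrite -horner_coef0 pc hornerZ horner_prod big1 ?mulr1 // => z _.
  by rewrite hornerD hornerN hornerZ hornerX mulr0 subr0 hornerC.
exists [seq z^-1 | z <- r]; split.
- by rewrite big_map pc c1 scale1r.
- by rewrite size_map.
- move=> _ /mapP[z zr ->]; rewrite invr_eq0 invrK rn0 //; split => //.
  by apply/eqP; rewrite -rootr.
Qed.

(** Up to sign the first two coefficients are elementary symmetric functions;
    Newton's identity brings in the sum of the squares. *)
Lemma coef_prod_rev (s : seq R[i]) (p := \prod_(z <- s) (1 - z *: 'X)) :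
  [/\ p`_0 = 1, p`_1 = - \sum_(z <- s) z &
      p`_2 *+ 2 = (\sum_(z <- s) z) ^+ 2 - \sum_(z <- s) z ^+ 2].
Proof.
rewrite /p {p}; elim: s => [|z s [IH0 IH1 IH2]].
  by rewrite !big_nil !coef1 /= mul0rn oppr0; split => //; ring.
rewrite !big_cons mulrBl mul1r -scalerAl.
rewrite !coefB !coefZ !coefXM /= IH0 IH1 mulrnBl IH2 mulr0 subr0 mulr1.
by split => //; ring.
Qed.

Variables (A : comUnitAlgType R[i]) (N : A -> R).
Hypothesis NA : algebra_norm N.
Variable f : A -> R[i].
Hypothesis fD : {morph f : x y / x + y}.
Hypothesis fZ : forall a x, f (a *: x) = a * f x.
Hypothesis f1 : f 1 = 1.
Hypothesis f_unit : forall x, x \is a GRing.unit -> f x != 0.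

(** The polynomial [f ((1 - t x) ^ n)] in [t] only vanishes at inverses [z^-1] of
    points [z] of the spectrum of [x], so it is a product of at most [n]
    factors [1 - z t] with [z] bounded by [N x]. Its coefficients of degree 1
    and 2 give [\sum z = n f x] and
    [\sum z ^ 2 = (n f x) ^ 2 - n (n - 1) f (x ^ 2)], while [\sum z ^ 2] is only
    [O(n)]. Hence [f (x ^ 2) - f x ^ 2] is [O(1 / n)]. *)
Lemma nonvanishing_sqr x : f (x ^+ 2) = f x ^+ 2.
Proof.
have f0 : f 0 = 0 by rewrite -(scale0r (0 : A)) fZ mul0r.
have fMn y n : f (y *+ n) = f y *+ n.
  by rewrite -scaler_nat fZ mulr_natl.
have main n : (1 < n)%N ->
    n%:R * normc (f x ^+ 2 - f (x ^+ 2)) <= N x ^+ 2 + normc (f (x ^+ 2)).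
  move=> n1; have n0 : (0 < n)%N by exact: ltnW.
  pose p : {poly R[i]} := \poly_(k < n.+1) ((- 1) ^+ k * f (x ^+ k) *+ 'C(n, k)).
  have pE t : p.[t] = f ((1 - t *: x) ^+ n).
    rewrite horner_poly exprDn (big_morph f fD f0).
    apply: eq_bigr => k _; rewrite expr1n mul1r fMn.
    by rewrite -scaleNr exprZn fZ mulrnAl [(- t) ^+ k]exprNn; congr (_ *+ _); ring.
  have p0 : p`_0 = 1 by rewrite coef_poly /= bin0 mulr1n expr0 mul1r expr0.
  have p1 : p`_1 = - (f x *+ n).
    by rewrite coef_poly ltnS n0 bin1 expr1 mulN1r mulNrn.
  have p2 : p`_2 *+ 2 = f (x ^+ 2) *+ (n * n.-1).
    rewrite coef_poly ltnS n1 sqrrN expr1n mul1r -mulrnA; congr (_ *+ _).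
    by rewrite -[2%N in LHS]/(2`!) bin_ffact ffactnS ffactn1.
  have [s [ps szs sr]] := poly_normal_rev p0.
  have [_ s1 s2] := coef_prod_rev s; rewrite -ps p1 in s1; rewrite -ps p2 in s2.
  have {}s1 : \sum_(z <- s) z = f x *+ n by apply: oppr_inj.
  have sN z : z \in s -> normc z <= N x.
    move=> /sr[z0 /eqP]; rewrite pE => h.
    apply: (spectrum_bound NA); rewrite /spectrum /=.
    apply: contraTN h => u; apply: f_unit; rewrite unitrX //.
    have -> : 1 - z^-1 *: x = z^-1 *: (z%:A - x).
      by rewrite scalerBr scalerA mulVf // scale1r.
    by rewrite scaler_unit // unitfE invr_eq0.
  have sS : normc (\sum_(z <- s) z ^+ 2) <= n%:R * N x ^+ 2.
    apply: le_trans (normc_sum _ _ _) _.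
    apply: le_trans (_ : \sum_(z <- s) N x ^+ 2 <= _).
      rewrite big_seq [leRHS]big_seq; apply: ler_sum => z /sN zN.
      by rewrite normcX lerXn2r ?nnegrE ?normc_ge0 ?(norma_ge0 NA).
    rewrite big_const_seq count_predT iter_addr_0 -[leLHS]mulr_natl ler_wpM2r ?exprn_ge0 ?(norma_ge0 NA) //.
    by rewrite ler_nat szs -subn1 leq_subLR size_poly.
  have e : (f x ^+ 2 - f (x ^+ 2)) *+ (n * n) =
      \sum_(z <- s) z ^+ 2 - f (x ^+ 2) *+ n.
    have -> : \sum_(z <- s) z ^+ 2 = (f x *+ n) ^+ 2 - f (x ^+ 2) *+ (n * n.-1).
      by rewrite s2 s1; ring.
    rewrite -addrA -opprD -mulrnDr addnC -mulnS prednK // exprMn_n mulrnBl.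
    by rewrite -mulnn.
  have : normc ((f x ^+ 2 - f (x ^+ 2)) *+ (n * n)) <=
      n%:R * N x ^+ 2 + n%:R * normc (f (x ^+ 2)).
    rewrite e (le_trans (normcD _ _)) // normcN normcMn -[_ *+ n in leLHS]mulr_natl.
    by rewrite lerD2r.
  rewrite normcMn -[leLHS]mulr_natl natrM -mulrA -mulrDr ler_pM2l ?ltr0n //.
apply/esym/eqP; rewrite -subr_eq0 -normc_eq0 eq_le normc_ge0 andbT leNgt.
apply/negP => d0.
set d := normc _ in main d0.
pose K := N x ^+ 2 + normc (f (x ^+ 2)).
have := main (Num.truncn (K / d)).+2 isT.
have := truncnS_gt (K / d); rewrite ltr_pdivrMr // -natr1 => h.
by rewrite -natr1 mulrDl mul1r -/K; lra.
Qed.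

Lemma nonvanishing_mul : {morph f : x y / x * y}.
Proof.
move=> x y; have := nonvanishing_sqr (x + y).
rewrite sqrrD !fD !nonvanishing_sqr [in RHS]sqrrD => /addIr/addrI.
rewrite -mulr2n => h; apply: (@mulIf _ (2 : R[i])); first by rewrite pnatr_eq0.
by rewrite !mulr_natr.
Qed.

End GleasonKahaneZelazko.

Section KowalskiSlodkowski.
Variables (R : realType) (A : comUnitAlgType R[i]) (N : A -> R).
Hypothesis NA : algebra_norm N.
Variable u : A -> R[i].
Hypothesis uD : {morph u : x y / x + y}.
Hypothesis uZ : forall (r : R) x, u (r%:C *: x) = r%:C * u x.
Hypothesis u_spec : forall x, exists chi : character A, u x = chi x.

(** The complex linear functionals such that [Re \o u = Re \o phi1] and
    [Im \o u = Im \o phi2]. *)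
Let phi1 x : R[i] := Re (u x) +i* (- Re (u ('i%C *: x))).
Let phi2 x : R[i] := Im (u ('i%C *: x)) +i* Im (u x).

Let u_unit y : y \is a GRing.unit -> u y != 0.
Proof. by have [chi ->] := u_spec y => /(unit_characters NA). Qed.

Let u_scalar l : u l%:A = l.
Proof. by have [chi ->] := u_spec l%:A; rewrite character_scalar. Qed.

Let uZC a x : u (a *: x) = (Re a)%:C * u x + (Im a)%:C * u ('i%C *: x).
Proof. by rewrite -!uZ -uD scalerA -scalerDl {1}[a]complexE mulrC. Qed.

Let uiZC a x : u ('i%C *: (a *: x)) = (Re a)%:C * u ('i%C *: x) - (Im a)%:C * u x.
Proof.
rewrite scalerA uZC; case: a => p q /=; rewrite !mul0r !mul1r sub0r add0r.
by rewrite rmorphN mulNr addrC.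
Qed.

Let phi1D : {morph phi1 : x y / x + y}.
Proof.
move=> x y; rewrite /phi1 scalerDr !uD.
case: (u x) (u y) (u ('i%C *: x)) (u ('i%C *: y)) => [? ?] [? ?] [? ?] [? ?].
by apply: complex_inj => /=; ring.
Qed.

Let phi2D : {morph phi2 : x y / x + y}.
Proof.
move=> x y; rewrite /phi2 scalerDr !uD.
case: (u x) (u y) (u ('i%C *: x)) (u ('i%C *: y)) => [? ?] [? ?] [? ?] [? ?].
by apply: complex_inj => /=; ring.
Qed.

Let phi1Z a x : phi1 (a *: x) = a * phi1 x.
Proof.
rewrite /phi1 uiZC (uZC a).
case: a (u x) (u ('i%C *: x)) => [? ?] [? ?] [? ?].
by apply: complex_inj => /=; ring.
Qed.

Let phi2Z a x : phi2 (a *: x) = a * phi2 x.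
Proof.
rewrite /phi2 uiZC (uZC a).
case: a (u x) (u ('i%C *: x)) => [? ?] [? ?] [? ?].
by apply: complex_inj => /=; ring.
Qed.

Let phi1_1 : phi1 1 = 1.
Proof.
by apply: complex_inj; rewrite /phi1 /= ?u_scalar ?oppr0 // -(scale1r 1) u_scalar.
Qed.

Let phi2_1 : phi2 1 = 1.
Proof.
by apply: complex_inj; rewrite /phi2 /= ?u_scalar // -(scale1r 1) u_scalar.
Qed.

(** Otherwise [u] would vanish at the unit [a *: y]. *)
Let phi_unit y a : y \is a GRing.unit -> a != 0 ->
  Re (a * phi1 y) = 0 -> Im (a * phi2 y) = 0 -> False.
Proof.
move=> uy a0; rewrite -phi1Z -phi2Z /phi1 /phi2 /= => h1 h2.
have /u_unit/eqP : a *: y \is a GRing.unit by rewrite scaler_unit ?unitfE.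
by apply; exact: complex_inj.
Qed.

Let phi1_unit y : y \is a GRing.unit -> phi1 y != 0.
Proof.
move=> uy; apply/eqP => h.
have [b0|b0] := eqVneq (phi2 y) 0.
  by apply: (phi_unit uy (oner_neq0 _)); rewrite mul1r ?h ?b0.
apply: (@phi_unit y (phi2 y)^*%C uy); rewrite ?conjc_eq0 // ?h ?mulr0 //.
by case: (phi2 y) => p q /=; ring.
Qed.

Let phi2_unit y : y \is a GRing.unit -> phi2 y != 0.
Proof.
move=> uy; apply/eqP => h.
have [b0|b0] := eqVneq (phi1 y) 0.
  by apply: (phi_unit uy (oner_neq0 _)); rewrite mul1r ?h ?b0.
apply: (@phi_unit y ('i%C * (phi1 y)^*%C) uy); rewrite ?h ?mulr0 //.
  by rewrite mulf_neq0 ?conjc_eq0 // eq_complex /= oner_eq0 andbF.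
by case: (phi1 y) => p q /=; ring.
Qed.

Let phi1M := nonvanishing_mul NA phi1D phi1Z phi1_1 phi1_unit.
Let phi2M := nonvanishing_mul NA phi2D phi2Z phi2_1 phi2_unit.

Let i1 : (1 - 'i%C : R[i]) != 0.
Proof. by rewrite eq_complex /= subr0 oner_eq0. Qed.

(** On a unit, [phi1 - i phi2] does not vanish either. The square of
    [(phi1 - i phi2) / (1 - i)] is therefore also compatible with products, and
    comparing it with the squares of [phi1] and [phi2] gives
    [i (phi1 x - phi2 x) ^ 2 = 0]. *)
Let phi12 x : phi1 x = phi2 x.
Proof.
pose phi x := (phi1 x - 'i%C * phi2 x) / (1 - 'i%C).
have phiD : {morph phi : x y / x + y}.
  by move=> y z; rewrite /phi phi1D phi2D -mulrDl; congr (_ / _); ring.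
have phiZ a y : phi (a *: y) = a * phi y.
  by rewrite /phi phi1Z phi2Z [RHS]mulrA; congr (_ / _); ring.
have phi1' : phi 1 = 1 by rewrite /phi phi1_1 phi2_1 mulr1 divff.
have phi_u y : y \is a GRing.unit -> phi y != 0.
  move=> uy; rewrite mulf_neq0 ?invr_eq0 // subr_eq0; apply/eqP => h.
  apply: (@phi_unit y (phi2 y)^*%C uy); rewrite ?conjc_eq0 ?phi2_unit // ?h.
    by case: (phi2 y) => p q /=; ring.
  by case: (phi2 y) => p q /=; ring.
have := nonvanishing_sqr NA phiD phiZ phi1' phi_u x.
rewrite /phi !expr2 phi1M phi2M => h.
have : 'i%C * (phi1 x - phi2 x) ^+ 2 = 0.
  have {}h : (phi1 x * phi1 x - 'i%C * (phi2 x * phi2 x)) * (1 - 'i%C) =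
     (phi1 x - 'i%C * phi2 x) * (phi1 x - 'i%C * phi2 x).
    apply: (@mulIf _ ((1 - 'i%C)^-1 * (1 - 'i%C)^-1)); first by rewrite mulf_neq0 ?invr_eq0.
    have := h; rewrite -[RHS]mulrACA => <-.
    by rewrite [LHS]mulrA mulfK.
  transitivity ((phi1 x - 'i%C * phi2 x) * (phi1 x - 'i%C * phi2 x) -
    (phi1 x * phi1 x - 'i%C * (phi2 x * phi2 x)) * (1 - 'i%C)); first ring.
  by rewrite h subrr.
move/eqP; rewrite mulf_eq0 expf_eq0 /= subr_eq0 => /orP[|/eqP//].
by rewrite eq_complex /= oner_eq0 andbF.
Qed.

Lemma real_linear_spectral_character : exists chi : character A, u =1 chi.
Proof.
have [chi chiE] := character_exists phi1_1 phi1D phi1M phi1Z.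
exists chi => x; rewrite chiE; apply: complex_inj; first by [].
by rewrite phi12.
Qed.

End KowalskiSlodkowski.

(** * Spectral multiplicative functionals on the group of units *)

Lemma normc_cvg (R : realType) (s : nat -> R[i]) :
  (forall e : R, 0 < e ->
     exists n, forall m, (n <= m)%N -> normc (s n - s m) < e) ->
  exists L, forall e : R, 0 < e ->
     exists n, forall m, (n <= m)%N -> normc (L - s m) < e.
Proof.
move=> cs.
have real_cvg (t : nat -> R) : (forall n m, `|t n - t m| <= normc (s n - s m)) ->
    exists L, forall e : R, 0 < e ->
      exists n, forall m, (n <= m)%N -> `|L - t m| < e.
  move=> ht; have ct : cvg (t x @[x --> \oo]).
    apply: cauchy_cvg; apply: cauchy_exP => e /cs[n h].
    exists (t n), n => // m /h hm.
    by rewrite -ball_normE /=; apply: le_lt_trans (ht _ _) hm.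
  exists (lim (t x @[x --> \oo])) => e e0.
  by have [n _ h] := (cvgrPdist_lt _ _).1 ct _ e0; exists n.
have [|a ha] := real_cvg (fun n => Re (s n)).
  by move=> n m; rewrite -ReN -ReD Re_le_normc.
have [|b hb] := real_cvg (fun n => Im (s n)).
  by move=> n m; rewrite -ImN -ImD Im_le_normc.
exists (a +i* b) => e e0; have e2 : 0 < e / 2 by rewrite divr_gt0.
have [n1 h1] := ha _ e2; have [n2 h2] := hb _ e2.
exists (maxn n1 n2) => m; rewrite geq_max => /andP[/h1 {}h1 /h2 {}h2].
apply: le_lt_trans (normc_le_ReIm _) _.
rewrite ReD ImD ReN ImN /=; lra.
Qed.

Section LocalCharacter.
Variables (R : realType) (A : comUnitAlgType R[i]) (N : A -> R).
Hypothesis NA : algebra_norm N.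
Variable phi : A -> R[i].
Hypothesis phiM : forall x y, x \is a GRing.unit -> y \is a GRing.unit ->
  phi (x * y) = phi x * phi y.
Hypothesis phi_spec : forall x, x \is a GRing.unit ->
  exists chi : character A, phi x = chi x.
Implicit Types (f g h x : A) (k m n : nat).

(** Additive up to second order ([dD]), so that Hyers' method applies: the
    limit of [2 ^ k d (h / 2 ^ k)] is additive and differs from [d] by a term
    of second order. *)
Let d h := phi (1 + h) - 1.

Let dE h : N h < 1 -> exists chi : character A, d h = chi h.
Proof.
move=> h1; have [chi e] := phi_spec (norma_unit NA h1); exists chi.
by rewrite /d e rmorphD rmorph1 addrC addKr.
Qed.

Let d_bound h : N h < 1 -> normc (d h) <= N h.
Proof. by move=> /dE[chi ->]; exact: character_bound NA chi h. Qed.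

(** The units [(1 + f) (1 + g)] and [1 + (f + g)] differ by the product [f g];
    evaluate their quotient with one and the same character. *)
Let dD f g : N f <= 8^-1 -> N g <= 8^-1 ->
  normc (d (f + g) - (d f + d g)) <= 3 * (N f * N g).
Proof.
move=> hf hg.
have hfg : N (f + g) <= 4^-1 by have := normaD NA f g; lra.
have uf : 1 + f \is a GRing.unit by apply: (norma_unit NA); lra.
have ug : 1 + g \is a GRing.unit by apply: (norma_unit NA); lra.
have ufg : 1 + (f + g) \is a GRing.unit by apply: (norma_unit NA); lra.
have [c uc cE] : exists2 c, c \is a GRing.unit &
    c * (1 + (f + g)) = (1 + f) * (1 + g).
  exists ((1 + f) * (1 + g) / (1 + (f + g))); last by rewrite divrK.
  by rewrite !unitrM uf ug unitrV.
have [chi hc] := phi_spec uc.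
have hH : normc (d (f + g)) <= 4^-1 by apply: (le_trans (d_bound _) hfg); lra.
have hF : normc (d f) <= N f by apply: d_bound; lra.
have hG : normc (d g) <= N g by apply: d_bound; lra.
have hp := character_bound NA chi f; have hq := character_bound NA chi g.
have e : (1 + d f) * (1 + d g) * (1 + (chi f + chi g)) =
         (1 + d (f + g)) * ((1 + chi f) * (1 + chi g)).
  have e1 : (1 + d f) * (1 + d g) = chi c * (1 + d (f + g)).
    by rewrite /d ![1 + (_ - 1)]addrC !subrK -phiM // -cE phiM // hc.
  have e2 : (1 + chi f) * (1 + chi g) = chi c * (1 + (chi f + chi g)).
    by have := congr1 chi cE; rewrite !(rmorphM, rmorphD, rmorph1) /= => <-.
  by rewrite e1 e2; ring.
move: e hH hF hG hp hq.
move: (d (f + g)) (d f) (d g) (chi f) (chi g) => H F G p q e hH hF hG hp hq.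
have {}e : (F + G + F * G - H) * (1 + (p + q)) = (1 + H) * (p * q).
  have := congr1 (fun z => z - (1 + H) * (1 + (p + q))) e; rewrite -mulrBl.
  by move=> e'; transitivity (((1 + F) * (1 + G) - (1 + H)) * (1 + (p + q)));
    [ring|rewrite e'; ring].
have b1 : 3 / 4 <= normc (1 + (p + q)).
  have := normc_lbD 1 (p + q); rewrite normc1.
  by have := normcD p q; lra.
have b2 : normc (1 + H) <= 5 / 4 by have := normcD 1 H; rewrite normc1; lra.
have pq : normc (p * q) <= N f * N g by rewrite normcM ler_pM ?normc_ge0.
have FG : normc (F * G) <= N f * N g by rewrite normcM ler_pM ?normc_ge0.
have b3 : normc (F + G + F * G - H) * (3 / 4) <= 5 / 4 * (N f * N g).
  apply: le_trans (_ : normc (F + G + F * G - H) * normc (1 + (p + q)) <= _).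
    by rewrite ler_wpM2l ?normc_ge0.
  by rewrite -normcM e normcM ler_pM ?normc_ge0.
have -> : H - (F + G) = F * G - (F + G + F * G - H) by ring.
have := normcD (F * G) (- (F + G + F * G - H)); rewrite normcN.
have : 0 <= N f * N g by rewrite mulr_ge0 ?(norma_ge0 NA).
by lra.
Qed.

Let half : R := 2^-1.
Let z k h := (2 ^+ k : R[i]) * d ((half ^+ k)%:C *: h).

Let half_ge0 k : 0 <= half ^+ k. Proof. by rewrite exprn_ge0 // invr_ge0. Qed.

Let N_half k h : N ((half ^+ k)%:C *: h) = half ^+ k * N h.
Proof. by rewrite (normaZ NA) normc_real ger0_norm. Qed.

Let two_half k : (2 ^+ k : R) * half ^+ k = 1.
Proof. by rewrite -exprMn divff ?expr1n. Qed.

Let normc_two k : normc (2 ^+ k : R[i]) = 2 ^+ k.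
Proof. by rewrite normcX normc_nat. Qed.

Let zD k f g : half ^+ k * N f <= 8^-1 -> half ^+ k * N g <= 8^-1 ->
  normc (z k (f + g) - (z k f + z k g)) <= 3 * (N f * N g) * half ^+ k.
Proof.
move=> hf hg; rewrite /z -mulrDr -mulrBr normcM normc_two scalerDr.
have := dD (_ : N ((half ^+ k)%:C *: f) <= _) (_ : N ((half ^+ k)%:C *: g) <= _).
rewrite !N_half => /(_ hf hg) h.
apply: le_trans (ler_wpM2l (exprn_ge0 _ _) h) _ => //.
rewrite le_eqVlt; apply/orP; left; apply/eqP.
have := two_half k; move: (2 ^+ k) (half ^+ k) => a b ab.
by transitivity ((a * b) * (3 * (N f * N g) * b)); [ring|rewrite ab mul1r].
Qed.

Let z_rate k h : N h <= 8^-1 -> normc (z k h - d h) <= 3 * N h ^+ 2.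
Proof.
move=> hh.
suff : normc (z k h - d h) <= 3 * N h ^+ 2 * (1 - half ^+ k).
  move/le_trans; apply; rewrite ler_piMr ?mulr_ge0 ?exprn_ge0 ?(norma_ge0 NA) //.
  by rewrite gerBl.
elim: k => [|k IH].
  by rewrite /z !expr0 mul1r scale1r !subrr normc0 mulr0.
apply: le_trans (normc_triangle _ (z k h) _) _.
pose h1 := (half ^+ k.+1)%:C *: h.
have e : (half ^+ k)%:C *: h = h1 + h1.
  rewrite -scalerDl -rmorphD /=; congr (_%:C *: _).
  by rewrite exprS /half; lra.
have Nh1 : N h1 <= 8^-1.
  rewrite /h1 N_half (le_trans _ hh) // ler_piMl ?(norma_ge0 NA) //.
  by rewrite exprn_ile1 // /half; lra.
have := dD Nh1 Nh1; rewrite -e /h1 N_half => hd.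
have : normc (z k.+1 h - z k h) <= 3 * N h ^+ 2 * (half ^+ k / 4).
  have -> : z k.+1 h - z k h = 2 ^+ k * - (d ((half ^+ k)%:C *: h) - (d h1 + d h1)).
    by rewrite /z exprS -/h1; ring.
  rewrite normcM normc_two normcN.
  apply: le_trans (ler_wpM2l (exprn_ge0 _ _) hd) _ => //.
  rewrite le_eqVlt; apply/orP; left; apply/eqP.
  have := two_half k; rewrite exprS.
  have -> : half = 2^-1 by [].
  move: (2 ^+ k) (2^-1 ^+ k) => a b ab.
  by transitivity ((a * b) * (3 * N h ^+ 2 * (b / 4))); [field|rewrite ab mul1r].
have := ler_wpM2l (_ : 0 <= 3 * N h ^+ 2) (half_ge0 k).
rewrite mulr_ge0 ?exprn_ge0 ?(norma_ge0 NA) // mulr0 => /(_ isT).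
move: IH; rewrite [half ^+ k.+1]exprS /half.
by move: (3 * N h ^+ 2) (2^-1 ^+ k) => S t; lra.
Qed.

Let z_shift k j h : z (k + j)%N h = 2 ^+ k * z j ((half ^+ k)%:C *: h).
Proof.
by rewrite /z !exprD mulrA scalerA -rmorphM [half ^+ j * _]mulrC.
Qed.

Let half_small (c e : R) : 0 <= c -> 0 < e ->
  exists n, forall m, (n <= m)%N -> half ^+ m * c <= e.
Proof.
move=> c0 e0; have c1 : 0 < c + 1 by lra.
have h01 : 0 <= half < 1 by rewrite /half; lra.
have [n hn] := expr_small h01 (divr_gt0 e0 c1).
exists n => m nm; rewrite -(subnKC nm) exprD.
have b1 : half ^+ (m - n) <= 1 by rewrite exprn_ile1 // /half; lra.
apply: le_trans (_ : half ^+ n * (c + 1) <= _).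
  by apply: ler_pM; rewrite ?mulr_ge0 ?lerDl ?ler_piMr.
by rewrite -ler_pdivlMr // ltW.
Qed.

Let z_cauchy h (e : R) : 0 < e ->
  exists n, forall m, (n <= m)%N -> normc (z n h - z m h) < e.
Proof.
move=> e0; have h0 := norma_ge0 NA h; have e2 : 0 < e / 2 by rewrite divr_gt0.
have i8 : 0 < (8^-1 : R) by rewrite invr_gt0.
have [n1 hn1] := half_small h0 i8.
have c0 : 0 <= 3 * N h ^+ 2 by rewrite mulr_ge0 ?exprn_ge0.
have [n2 hn2] := half_small c0 e2.
pose n := maxn n1 n2; exists n => m nm; rewrite normcB.
rewrite -(subnKC nm) z_shift /z -mulrBr normcM normc_two.
have hs : N ((half ^+ n)%:C *: h) <= 8^-1 by rewrite N_half hn1 // leq_maxl.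
apply: le_lt_trans (ler_wpM2l (exprn_ge0 _ _) (z_rate (m - n) hs)) _ => //.
rewrite N_half; have := hn2 _ (leq_maxr n1 n2); rewrite -/n.
have := two_half n; move: (2 ^+ n) (half ^+ n) => a b ab hb.
have -> : a * (3 * (b * N h) ^+ 2) = (a * b) * (b * (3 * N h ^+ 2)) by ring.
by rewrite ab mul1r; lra.
Qed.

Let u h := xget 0 [set l | forall e : R, 0 < e ->
  exists n, forall m, (n <= m)%N -> normc (l - z m h) < e].

Let u_lim h (e : R) : 0 < e ->
  exists n, forall m, (n <= m)%N -> normc (u h - z m h) < e.
Proof.
have [l hl] := normc_cvg (z_cauchy h).
by rewrite /u; case: xgetP => [l' _ hl' /hl'//|/(_ l)].
Qed.

Let uD : {morph u : f g / f + g}.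
Proof.
move=> f g; apply/eqP; rewrite -subr_eq0; apply/eqP/normc_small_eq0 => e e0.
have e4 : 0 < e / 4 by rewrite divr_gt0.
have i8 : 0 < (8^-1 : R) by rewrite invr_gt0.
have Nf := norma_ge0 NA f; have Ng := norma_ge0 NA g.
have [n1 h1] := u_lim (f + g) e4.
have [n2 h2] := u_lim f e4.
have [n3 h3] := u_lim g e4.
have [n4 h4] := half_small Nf i8.
have [n5 h5] := half_small Ng i8.
have c0 : 0 <= 3 * (N f * N g) by rewrite !mulr_ge0.
have [n6 h6] := half_small c0 e4.
pose m := maxn n1 (maxn n2 (maxn n3 (maxn n4 (maxn n5 n6)))).
have {}h1 := h1 m (leq_maxl _ _).
have {}h2 : normc (u f - z m f) < e / 4 by apply: h2; rewrite /m !leq_max leqnn /= ?orbT.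
have {}h3 : normc (u g - z m g) < e / 4 by apply: h3; rewrite /m !leq_max leqnn /= ?orbT.
have {}h4 : half ^+ m * N f <= 8^-1 by apply: h4; rewrite /m !leq_max leqnn /= ?orbT.
have {}h5 : half ^+ m * N g <= 8^-1 by apply: h5; rewrite /m !leq_max leqnn /= ?orbT.
have {}h6 : half ^+ m * (3 * (N f * N g)) <= e / 4 by apply: h6; rewrite /m !leq_max leqnn /= ?orbT.
have := zD h4 h5; rewrite mulrC => h7.
have -> : u (f + g) - (u f + u g) = (u (f + g) - z m (f + g)) +
  ((z m (f + g) - (z m f + z m g)) + ((z m f - u f) + (z m g - u g))) by ring.
have := normcD (z m f - u f) (z m g - u g).
rewrite [normc (z m f - _)]normcB [normc (z m g - _)]normcB.
have := normcD (z m (f + g) - (z m f + z m g)) ((z m f - u f) + (z m g - u g)).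
have := normcD (u (f + g) - z m (f + g))
  ((z m (f + g) - (z m f + z m g)) + ((z m f - u f) + (z m g - u g))).
by lra.
Qed.

Let u_rate h : N h <= 8^-1 -> normc (u h - d h) <= 3 * N h ^+ 2.
Proof.
move=> hh; apply/ler_addgt0Pl => e e0; have [n hn] := u_lim h e0.
have := hn _ (leqnn n); have := z_rate n hh.
by have := normc_triangle (u h) (z n h) (d h); lra.
Qed.

(** The spectrum is closed: if [u h - h] were invertible, its values at the
    characters would be bounded away from 0, although [z m h] is the value of
    [h] at some character and tends to [u h]. *)
Let u_spec h : exists chi : character A, u h = chi h.
Proof.
have [[chi e]|nE] := pselect (exists chi : character A, chi h = u h); first by exists chi.
exfalso; have /negP : ~ spectrum h (u h) by move/(spectrum_characters NA).
rewrite /spectrum /= negbK; set y := _ - h => uy.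
have i0 := norma_ge0 NA y^-1.
have e0 : 0 < (N y^-1 + 1)^-1 by rewrite invr_gt0; lra.
have [n1 hn1] := u_lim h e0.
have i2 : 0 < (2^-1 : R) by rewrite invr_gt0.
have [n2 hn2] := half_small (norma_ge0 NA h) i2.
pose m := maxn n1 n2.
have hm : N ((half ^+ m)%:C *: h) < 1.
  by rewrite N_half (le_lt_trans (hn2 _ (leq_maxr _ _))) //; lra.
have [chi hchi] := dE hm.
have zE : z m h = chi h.
  rewrite /z hchi linearZ /= mulrA.
  have -> : (2 ^+ m : R[i]) * (half ^+ m)%:C = 1; last by rewrite mul1r.
  by rewrite -(rmorph_nat (real_complex R)) -rmorphXn -rmorphM /= two_half.
have := hn1 _ (leq_maxl n1 n2); rewrite -/m zE.
have -> : u h - chi h = chi y by rewrite /y rmorphB /= character_scalar.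
have : normc (chi y^-1 * chi y) = 1 by rewrite -rmorphM mulVr // rmorph1 normc1.
rewrite normcM; have := character_bound NA chi y^-1.
move: (normc (chi y^-1)) (normc (chi y)) (N y^-1) i0 e0 (normc_ge0 (chi y)).
move=> a b c c0 e0 b0 ac ab bc.
have : b * (c + 1) < 1 by rewrite -ltr_pdivlMr ?div1r //; lra.
have : a * b <= c * b by rewrite ler_wpM2r.
by lra.
Qed.

Let u_bound h : normc (u h) <= N h.
Proof. by have [chi ->] := u_spec h; exact: character_bound NA chi h. Qed.

(** An additive functional bounded by the norm is real linear: write [n r] as
    an integer plus a bounded remainder and divide by [n]. *)
Let uZ (r : R) x : u (r%:C *: x) = r%:C * u x.
Proof.
have uB : additive u.
  have u0 : u 0 = 0 by apply: (addrI (u 0)); rewrite -uD !addr0.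
  move=> f g; rewrite uD; congr (_ + _).
  by apply: (addrI (u g)); rewrite -uD !subrr u0.
pose U : {additive A -> R[i]} := HB.pack u (GRing.isAdditive.Build A R[i] u uB).
have uMz y (m : int) : u (y *~ m) = u y *~ m by exact: (raddfMz U).
apply/eqP; rewrite -subr_eq0; apply/eqP/normc_small_eq0 => e e0.
have Nx := norma_ge0 NA x.
pose n := (Num.truncn (2 * N x / e)).+1.
have hn : 2 * N x < n%:R * e.
  by rewrite -ltr_pdivrMr // truncnS_gt.
have n0 : 0 < n%:R :> R by rewrite ltr0n.
pose m := Num.floor (n%:R * r); pose s := n%:R * r - m%:~R.
have s0 : 0 <= s by rewrite subr_ge0 floor_le.
have s1 : s <= 1 by rewrite lerBlDl; have := floorD1_gt (n%:R * r); rewrite intrD => /ltW.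
have e1 : (u (r%:C *: x) - r%:C * u x) *+ n = u (s%:C *: x) - s%:C * u x.
  have ux : (r%:C *: x) *+ n = x *~ m + s%:C *: x.
    rewrite -scaler_nat scalerA -scaler_int -scalerDl; congr (_ *: _).
    rewrite -(rmorph_nat (real_complex R)) -rmorphM -(rmorph_int (real_complex R)) -rmorphD /=.
    by congr (_%:C); rewrite /s addrC subrK.
  rewrite mulrnBl -[u _ *+ n](uMz _ n) -[_ *~ n]/(_ *+ n) ux uD uMz.
  have -> : r%:C * u x *+ n = u x *~ m + s%:C * u x.
    rewrite -mulr_natl mulrA -mulrzl -mulrDl; congr (_ * _).
    rewrite -(rmorph_nat (real_complex R)) -rmorphM -(rmorph_int (real_complex R)) -rmorphD /=.
    by congr (_%:C); rewrite /s addrC subrK.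
  by ring.
have b : normc (u (r%:C *: x) - r%:C * u x) * n%:R <= 2 * N x.
  rewrite mulr_natr -normcMn e1 (le_trans (normcD _ _)) // normcN normcM.
  have := u_bound (s%:C *: x); rewrite (normaZ NA) normc_real ger0_norm //.
  have : s * N x <= N x by rewrite ler_piMl.
  have : s * normc (u x) <= N x.
    by apply: le_trans (u_bound x); rewrite ler_piMl ?normc_ge0.
  by lra.
rewrite -(ler_pM2r n0); apply: le_trans b _; rewrite [e * _]mulrC.
exact: ltW.
Qed.

Let phi_scalar l : l != 0 -> phi l%:A = l.
Proof.
move=> l0; have ul : l%:A \is a @GRing.unit A by rewrite scaler_unit ?unitr1 ?unitfE.
by have [chi ->] := phi_spec ul; rewrite character_scalar.
Qed.

(** [phi] and its derivative [upsilon] at 1 agree to second order at 1. The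
    segment from 1 to [1 + g] is cut in [n] pieces, each contributing a
    factor [1 + O(1 / n ^ 2)] to the quotient of the two. *)
Let phi_near1 (upsilon : character A) g : u =1 upsilon -> N g <= 2^-1 ->
  phi (1 + g) = upsilon (1 + g).
Proof.
move=> uE hg.
have N1 := norma1_ge1 NA.
pose K := 12 * N 1 ^+ 2.
have K0 : 0 <= K by rewrite mulr_ge0 ?exprn_ge0 //; lra.
have up_bound h : normc (upsilon h) <= N h by exact: character_bound NA upsilon h.
have phi_b h : N h <= 2^-1 -> normc (phi (1 + h)) <= 3 / 2.
  move=> hh; have hd : normc (d h) <= N h by apply: d_bound; lra.
  have := normcD 1 (d h); rewrite normc1 /d addrC subrK -/(d h); lra.
have up_b h : N h <= 2^-1 -> 2^-1 <= normc (upsilon (1 + h)).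
  move=> hh; rewrite rmorphD rmorph1.
  by have := normc_lbD 1 (upsilon h); rewrite normc1; have := up_bound h; lra.
have up_n0 h : N h <= 2^-1 -> upsilon (1 + h) != 0.
  by move=> /up_b hh; rewrite -normc_gt0; lra.
have main n : 8 * N 1 <= n%:R -> (0 < n)%N ->
    normc (phi (1 + g) / upsilon (1 + g) - 1) <= K / n%:R.
  move=> hn n0; have nR : 0 < n%:R :> R by rewrite ltr0n.
  pose x j : A := (j%:R / n%:R)%:C *: g.
  have Nx j : (j <= n)%N -> N (x j) <= 2^-1.
    move=> jn; rewrite /x (normaZ NA) normc_real ger0_norm ?divr_ge0 //.
    apply: le_trans hg; rewrite ler_piMl ?(norma_ge0 NA) //.
    by rewrite ler_pdivrMr // mul1r ler_nat.
  have ux j : (j <= n)%N -> 1 + x j \is a GRing.unit.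
    by move=> /Nx h; apply: (norma_unit NA); lra.
  pose e j := phi (1 + x j) / upsilon (1 + x j).
  have eb j : (j <= n)%N -> normc (e j) <= 3.
    move=> jn; have a := phi_b _ (Nx _ jn); have b := up_b _ (Nx _ jn).
    rewrite /e normcM normcV ler_pdivrMr; last lra.
    by lra.
  have step j : (j < n)%N -> normc (e j.+1 - e j) <= K / n%:R ^+ 2.
    move=> jn; have jn' := ltnW jn.
    pose h := (n%:R^-1)%:C *: g / (1 + x j).
    have xS : 1 + x j.+1 = (1 + x j) * (1 + h).
      rewrite mulrDr mulr1 /h [_ * (_ / _)]mulrC divrK ?ux // -addrA; congr (_ + _).
      rewrite /x -scalerDl -rmorphD /=; congr (_%:C *: _).
      by rewrite -addn1 natrD mulrDl div1r.
    have Nh : N h <= N 1 / n%:R.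
      apply: le_trans (normaM NA _ _) _; rewrite (normaZ NA) normc_real.
      rewrite ger0_norm ?invr_ge0 // [N 1 / _]mulrC -mulrA ler_wpM2l ?invr_ge0 //.
      have := norma_inv_le NA (Nx _ jn'); have := norma_ge0 NA (1 + x j)^-1.
      move: (N _^-1) => a a0 ha; apply: le_trans (_ : 2^-1 * (2 * N 1) <= _).
        by rewrite ler_pM ?(norma_ge0 NA).
      by lra.
    have Nh8 : N h <= 8^-1.
      by apply: le_trans Nh _; rewrite ler_pdivrMr //; lra.
    have uh : 1 + h \is a GRing.unit by apply: (norma_unit NA); lra.
    have w0 : upsilon (1 + h) != 0 by apply: up_n0; lra.
    have -> : e j.+1 - e j = e j * ((phi (1 + h) - upsilon (1 + h)) / upsilon (1 + h)).
      rewrite /e xS phiM ?ux // rmorphM /=.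
      have v0 := up_n0 _ (Nx _ jn').
      move: (upsilon (1 + h)) w0 (upsilon (1 + x j)) v0 => a a0 b b0.
      by field; rewrite a0 b0.
    rewrite [normc (e j * _)]normcM [normc ((_ - _) / _)]normcM normcV.
    have r : normc (phi (1 + h) - upsilon (1 + h)) <= 3 * N h ^+ 2.
      have -> : phi (1 + h) - upsilon (1 + h) = - (u h - d h).
        by rewrite uE /d rmorphD rmorph1 /=; ring.
      by rewrite normcN u_rate.
    have r2 : 3 * N h ^+ 2 <= 3 * (N 1 / n%:R) ^+ 2.
      by rewrite ler_wpM2l // lerXn2r ?nnegrE ?(norma_ge0 NA) ?divr_ge0 //; lra.
    have w : 3 / 4 <= normc (upsilon (1 + h)).
      rewrite rmorphD rmorph1 /=.
      by have := normc_lbD 1 (upsilon h); rewrite normc1; have := up_bound h; lra.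
    have -> : K / n%:R ^+ 2 = 3 * (4 * (N 1 / n%:R) ^+ 2).
      by rewrite /K; field; rewrite gt_eqF.
    apply: ler_pM; rewrite ?normc_ge0 ?eb // ?divr_ge0 ?normc_ge0 //.
    rewrite ler_pdivrMr; last lra.
    have : 0 <= (N 1 / n%:R) ^+ 2 by rewrite exprn_ge0 // divr_ge0 //; lra.
    by move: ((N 1 / n%:R) ^+ 2) r2 r w => a; nra.
  have e0 : e 0%N = 1.
    rewrite /e /x mul0r scale0r addr0 rmorph1 divr1 -(scale1r 1).
    by rewrite phi_scalar ?oner_neq0.
  have tele j : (j <= n)%N -> normc (e j - 1) <= j%:R * (K / n%:R ^+ 2).
    elim: j => [|j IH] jn; first by rewrite e0 subrr normc0 mul0r.
    apply: le_trans (normc_triangle _ (e j) _) _.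
    have := step j jn; have := IH (ltnW jn); rewrite -natr1 mulrDl mul1r; lra.
  have := tele n (leqnn n); rewrite /e /x divff ?gt_eqF // scale1r.
  move/le_trans; apply; rewrite le_eqVlt; apply/orP; left; apply/eqP.
  by field; rewrite gt_eqF.
have : phi (1 + g) / upsilon (1 + g) - 1 = 0.
  apply: normc_small_eq0 => e e0.
  pose n := (Num.truncn (Num.max (8 * N 1) (K / e))).+1.
  have hn : Num.max (8 * N 1) (K / e) < n%:R by exact: truncnS_gt.
  have [hn1 hn2] : 8 * N 1 < n%:R /\ K / e < n%:R.
    by move: hn; rewrite gt_max => /andP.
  apply: le_trans (main n (ltW hn1) isT) _.
  rewrite ler_pdivrMr ?ltr0n // mulrC -ler_pdivrMr //; exact: ltW.
move/eqP; rewrite subr_eq0 => /eqP h.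
by rewrite -[LHS](divfK (up_n0 _ hg)) h mul1r.
Qed.

(** Dividing by [l], at which [phi] takes the value [l], reduces this to
    elements near 1. *)
Lemma local_character : exists upsilon : character A,
  forall l g, l != 0 -> 2 * N g <= normc l -> phi (l%:A + g) = l + upsilon g.
Proof.
have [upsilon uE] := real_linear_spectral_character NA uD uZ u_spec.
exists upsilon => l g l0 hg.
have ng : N (l^-1 *: g) <= 2^-1.
  rewrite (normaZ NA) normcV mulrC ler_pdivrMr ?normc_gt0 //; lra.
have -> : l%:A + g = l%:A * (1 + l^-1 *: g).
  by rewrite mulr_algl scalerDr scalerA divff // scale1r.
rewrite phiM.
- rewrite phi_scalar // (phi_near1 uE ng) rmorphD rmorph1 /= linearZ /=.
  by rewrite mulrDr mulr1 mulVKf.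
- by rewrite scaler_unit ?unitr1 ?unitfE.
- by apply: (norma_unit NA); apply: (le_lt_trans ng); lra.
Qed.

End LocalCharacter.

(** * Extension to an algebra morphism *)

(** Side conditions of [local_character] for a positive scalar. *)
Lemma large_scalar (R : realType) (A : comUnitAlgType R[i]) (N : A -> R)
    (NA : algebra_norm N) (L : R) (f : A) : 0 < L -> 2 * N f <= L ->
  [/\ L%:C != 0 :> R[i], 2 * N f <= normc L%:C & L%:C%:A + f \is a GRing.unit].
Proof.
move=> L0 hL; have nL : normc L%:C = L by rewrite normc_real gtr0_norm.
have Nf := norma_ge0 NA f.
rewrite -normc_gt0 nL; split => //; apply: (norma_unit_large NA).
by rewrite nL; lra.
Qed.

Section Extension.
Variables (R : realType) (A B : comUnitAlgType R[i]) (N : A -> R).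
Hypothesis NA : algebra_norm N.
Hypothesis ssB : forall y : B, (forall psi : character B, psi y = 0) -> y = 0.
Variable tau : A -> B.
Hypothesis tauM : forall x y, x \is a GRing.unit -> y \is a GRing.unit ->
  tau (x * y) = tau x * tau y.
Hypothesis tau_spec : forall x (psi : character B), x \is a GRing.unit ->
  exists chi : character A, psi (tau x) = chi x.

Let eqB (y z : B) : (forall psi : character B, psi y = psi z) -> y = z.
Proof.
move=> h; apply/eqP; rewrite -subr_eq0; apply/eqP/ssB => psi.
by rewrite rmorphB /= h subrr.
Qed.

(* The scalar [shift f] is large enough for [local_character] to apply to
   [(shift f)%:A + f]. *)
Let shift (f : A) : R[i] := (2 * N f + 1)%:C.

Let extension_pointwise : exists s : A -> B, forall psi : character B,
  exists upsilon : character A, (forall f, psi (s f) = upsilon f) /\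
  forall l g, l != 0 -> 2 * N g <= normc l ->
    psi (tau (l%:A + g)) = upsilon (l%:A + g).
Proof.
exists (fun f => tau ((shift f)%:A + f) - (shift f)%:A) => psi.
have [||upsilon h] := @local_character R A N NA (fun x => psi (tau x)).
- by move=> x y ux uy; rewrite tauM // rmorphM.
- by move=> x ux; exact: tau_spec.
exists upsilon; split=> [f|l g l0 hg]; last first.
  by rewrite h // rmorphD /= character_scalar.
have Nf := norma_ge0 NA f.
have [||s0 hs _] := large_scalar NA (L := 2 * N f + 1) (f := f); [lra|lra|].
rewrite rmorphB /= character_scalar h //.
by rewrite addrAC subrr add0r.
Qed.

(** Each [psi \o s] is a character of [A], so [s] is an algebra morphism
    because the characters [psi] separate the points of [B]. *)
Lemma spectral_morphism_extension : exists S : {lrmorphism A -> B},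
  forall l g, l != 0 -> 2 * N g <= normc l -> tau (l%:A + g) = S (l%:A + g).
Proof.
have [s sP] := extension_pointwise.
have [||||S SE] := @lrmorphism_exists _ A B s.
- by apply: eqB => psi; have [u [-> _]] := sP psi; rewrite !rmorph1.
- move=> x y; apply: eqB => psi; have [u [uE _]] := sP psi.
  by rewrite rmorphD /= !uE rmorphD.
- move=> x y; apply: eqB => psi; have [u [uE _]] := sP psi.
  by rewrite rmorphM /= !uE rmorphM.
- move=> a x; apply: eqB => psi; have [u [uE _]] := sP psi.
  by rewrite linearZ /= !uE linearZ.
exists S => l g l0 hg; apply: eqB => psi; have [u [uE uN]] := sP psi.
by rewrite uN // SE uE.
Qed.

End Extension.

(** Shift [f] by a scalar large enough for both [f] and [S f]: there [S] and [S']
    are [tau] and [sigma], which cancel. *)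
Lemma extension_cancel (R : realType) (A B : comUnitAlgType R[i])
    (N : A -> R) (NB : B -> R) (NA : algebra_norm N) (NBA : algebra_norm NB)
    (tau : A -> B) (sigma : B -> A)
    (S : {lrmorphism A -> B}) (S' : {lrmorphism B -> A}) :
  (forall x, x \is a GRing.unit -> sigma (tau x) = x) ->
  (forall l g, l != 0 -> 2 * N g <= normc l -> tau (l%:A + g) = S (l%:A + g)) ->
  (forall l g, l != 0 -> 2 * NB g <= normc l ->
     sigma (l%:A + g) = S' (l%:A + g)) ->
  cancel S S'.
Proof.
move=> tauK tS sS f.
have Nf := norma_ge0 NA f; have NSf := norma_ge0 NBA (S f).
pose L := 2 * N f + 2 * NB (S f) + 1.
have [||L0 hA uA] := large_scalar NA (L := L) (f := f); [rewrite /L; lra..|].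
have [||_ hB _] := large_scalar NBA (L := L) (f := S f); [rewrite /L; lra..|].
have Sl l : S l%:A = l%:A by rewrite linearZ /= rmorph1.
have S'l l : S' l%:A = l%:A by rewrite linearZ /= rmorph1.
move: (L%:C) L0 hA uA hB => l l0 hA uA hB.
have eS : S (l%:A + f) = l%:A + S f by rewrite rmorphD /= Sl.
have := sS _ _ l0 hB; rewrite -{1}eS -{1}tS // tauK // rmorphD /= S'l.
by move/addrI.
Qed.

(** * Rigidity of spectrum-preserving automorphisms of the group of units *)

Lemma geometric_growth (R : realType) (a b p q : R) :
  0 < a -> 0 <= b -> 0 <= p -> p < q -> exists n, b * p ^+ n < a * q ^+ n.
Proof.
move=> a0 b0 p0 pq; have q0 : 0 < q by exact: le_lt_trans pq.
have r01 : 0 <= p / q < 1 by rewrite divr_ge0 ?(ltW q0) //= ltr_pdivrMr // mul1r.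
have b1 : 0 < b + 1 by lra.
have [n hn] := expr_small r01 (divr_gt0 a0 b1).
exists n; move: hn; rewrite expr_div_n ltr_pdivrMr ?exprn_gt0 // mulrAC.
rewrite ltr_pdivlMr // mulrC; apply: le_lt_trans.
by rewrite ler_wpM2r ?exprn_ge0 //; lra.
Qed.

Section Rigidity.
Variables (R : realType) (A : comUnitAlgType R[i]) (N : A -> R).
Hypothesis NA : algebra_norm N.
Hypothesis ssA : forall x : A, (forall chi : character A, chi x = 0) -> x = 0.
Variable U : A -> A.
Hypothesis UM : forall x y, x \is a GRing.unit -> y \is a GRing.unit ->
  U (x * y) = U x * U y.
Hypothesis U_unit : forall x, x \is a GRing.unit -> U x \is a GRing.unit.
Hypothesis U_spec : forall x (chi : character A), x \is a GRing.unit ->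
  exists chi' : character A, chi (U x) = chi' x.
Hypothesis U_spec' : forall x (chi : character A), x \is a GRing.unit ->
  exists chi' : character A, chi x = chi' (U x).
Hypothesis U_near : forall l g, l != 0 -> 2 * N g <= normc l ->
  U (l%:A + g) = l%:A + g.

Let chi_n0 (chi : character A) x : x \is a GRing.unit -> 0 < normc (chi x).
Proof. by move=> /(unit_characters NA)/(_ chi); rewrite normc_gt0. Qed.

Let near_max (chi0 : character A) x (e : R) : 0 < e ->
  exists chi1 : character A, forall chi : character A,
    normc (chi x) <= normc (chi1 x) + e.
Proof.
move=> e0; pose E := [set normc (chi x) | chi in [set: character A]].
have sE : has_sup E.
  split; first by exists (normc (chi0 x)), chi0.
  by exists (N x) => _ [chi _ <-]; exact: character_bound NA chi x.
have [_ [chi1 _ <-] h] := sup_adherent e0 sE.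
exists chi1 => chi; rewrite -lerBlDr; apply: le_trans (ltW h).
by rewrite lerD2r; apply: sup_upper_bound => //; exists chi.
Qed.

Let U1 : U 1 = 1.
Proof.
have := U_near (l := 1) (g := 0); rewrite addr0 scale1r (norma0 NA) mulr0.
by rewrite normc1; apply; rewrite ?oner_neq0.
Qed.

Let U_exp y n : y \is a GRing.unit -> U y = y -> U (y ^+ n) = y ^+ n.
Proof.
move=> uy Uy; elim: n => [|n IH]; first exact: U1.
by rewrite exprS UM ?unitrX // Uy IH.
Qed.

(** Suppose that [k] has a value [rho] of modulus larger than 1, at [chi0]. The
    powers of [L + theta k] peak where [k] is close to [rho], and [x] inherits
    this. But at a character where [x] is almost maximal, [x k] is not larger
    than the maximum of [x], since [U x = x k] has the same spectrum; hence the
    modulus of [k] is at most about 1 there. *)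
Let quot_bound f (chi0 : character A) : f \is a GRing.unit ->
  normc (chi0 (U f / f)) <= 1.
Proof.
move=> uf; set k := U f / f; have Uf : U f = f * k by rewrite mulrC divrK.
rewrite leNgt; apply/negP; set rho := normc _ => rho1.
pose del := (1 + rho) / 2.
have del1 : 1 < del by rewrite /del; lra.
have delr : del < rho by rewrite /del; lra.
have k0 : chi0 k != 0 by rewrite -normc_gt0 -/rho; lra.
(* The phase that turns [chi0 k] into [rho]. *)
pose theta : R[i] := rho%:C / chi0 k.
have nth : normc theta = 1.
  by rewrite /theta normcM normcV normc_real ger0_norm ?divff ?gt_eqF // -/rho; lra.
have Nk := norma_ge0 NA k.
pose L := 2 * N k + 1.
have Ntk : N (theta *: k) = N k by rewrite (normaZ NA) nth mul1r.
have [||L0 hL uy] := large_scalar NA (L := L) (f := theta *: k).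
- by rewrite /L; lra.
- by rewrite Ntk /L; lra.
set y := L%:C%:A + theta *: k in uy.
have Uy : U y = y by exact: U_near.
have yE (chi : character A) : normc (chi y) <= L + normc (chi k).
  rewrite rmorphD /= character_scalar linearZ /= (le_trans (normcD _ _)) //.
  by rewrite normcM nth mul1r normc_real ger0_norm // /L; lra.
have y0E : normc (chi0 y) = L + rho.
  rewrite rmorphD /= character_scalar linearZ /= /theta divfK //.
  by rewrite -rmorphD normc_real ger0_norm // /L; lra.
have Nf := norma_ge0 NA f.
have [||||n hn] := @geometric_growth R (normc (chi0 f)) (del * N f) (L + del) (L + rho).
- exact: chi_n0.
- by rewrite mulr_ge0 //; lra.
- by rewrite /L; lra.
- by lra.
pose x := f * y ^+ n.
have ux : x \is a GRing.unit by rewrite unitrM uf unitrX.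
have Ux : U x = x * k.
  by rewrite UM ?unitrX // U_exp // Uf mulrAC.
have m0 := chi_n0 chi0 ux.
have e0 : 0 < normc (chi0 x) * (del - 1) / del.
  by rewrite divr_gt0 ?mulr_gt0 //; lra.
have [chi1 h1] := near_max chi0 x e0.
have d0 : 0 < del by lra.
have e1 : normc (chi0 x) * (del - 1) / del = normc (chi0 x) - normc (chi0 x) / del.
  by field; rewrite gt_eqF.
have x1 : normc (chi0 x) <= normc (chi1 x) * del.
  by rewrite -ler_pdivrMr //; have := h1 chi0; lra.
have k1 : normc (chi1 k) <= del.
  have [chi2 h2] := U_spec chi1 ux.
  have {h1} := h1 chi2; rewrite -h2 Ux rmorphM normcM => h1.
  have b0 := chi_n0 chi1 ux.
  rewrite -(lerD2r (-1)) -(ler_pM2l (mulr_gt0 b0 d0)).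
  apply: le_trans (_ : normc (chi0 x) * (del - 1) <= _); last first.
    by rewrite ler_wpM2r //; lra.
  rewrite [_ * del]mulrC -mulrA -ler_pdivlMl // [_^-1 * _]mulrC mulrBr mulr1.
  by rewrite lerBlDl.
move: hn; rewrite ltNge => /negP; apply.
have -> : normc (chi0 f) * (L + rho) ^+ n = normc (chi0 x).
  by rewrite /x rmorphM rmorphXn normcM normcX y0E.
apply: le_trans x1 _; rewrite [leLHS]mulrC -[leRHS]mulrA.
apply: ler_wpM2l; first lra.
rewrite /x rmorphM rmorphXn normcM normcX.
apply: ler_pM; rewrite ?normc_ge0 ?exprn_ge0 ?normc_ge0 //.
  exact: character_bound NA chi1 f.
rewrite lerXn2r ?nnegrE ?normc_ge0 //; first by rewrite /L; lra.
by apply: le_trans (yE chi1) _; rewrite lerD2l.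
Qed.

Let quot_norm1 f (chi : character A) : f \is a GRing.unit ->
  normc (chi (U f / f)) = 1.
Proof.
move=> uf; have uV : f^-1 \is a GRing.unit by rewrite unitrV.
have UV : U f^-1 = (U f)^-1.
  by rewrite -[LHS](mulrK (U_unit uf)) -UM // mulVr // U1 mul1r.
have := quot_bound chi uV; rewrite UV -invrM ?unitrV ?U_unit //.
rewrite [_ * U f]mulrC.
have := quot_bound chi uf.
have uk : U f / f \is a GRing.unit by rewrite unitrM U_unit.
have := chi_n0 chi uk; rewrite rmorphV // normcV.
move: (normc _) => a a0 a1; rewrite invf_le1 // => a2.
by apply/eqP; rewrite eq_le a1 a2.
Qed.

(** The quotient [k] of [U f] by [f] has modulus 1 at every character; suppose
    that its value at [chi0] is not 1. The powers of [L - k] push the maximum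
    of the modulus of [g := f (L - k) ^ n] away from the characters where [k] is
    close to 1. On the other hand [U] still multiplies [g + dl] by [k] for small
    scalars [dl]. If [dl] is aligned with a value of almost maximal modulus of
    [g], then [U (g + dl)] takes the same value at some character [chi1], and the
    triangle inequality for [chi1 (g k) + dl * chi1 k] is almost an equality:
    [g] is almost maximal at [chi1] and [k] is almost 1 there. *)
Lemma spectral_automorphism_rigid f : f \is a GRing.unit -> U f = f.
Proof.
move=> uf; set k := U f / f.
suff k_eq1 : k = 1.
  by have := congr1 (fun x => x * f) k_eq1; rewrite /k divrK // mul1r.
apply/eqP; rewrite -subr_eq0; apply/eqP/ssA => chi0.
rewrite rmorphB rmorph1 /=; apply/eqP; rewrite subr_eq0; apply/eqP.
have nk (chi : character A) : normc (chi k) = 1 by exact: quot_norm1.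
have Uf : U f = f * k by rewrite mulrC divrK.
pose c := Re (chi0 k).
have [c1|c1] := leP 1 c.
  have := normc_sqrE (chi0 k); rewrite nk expr1n -/c => h.
  have c2 : c = 1 by have := sqr_ge0 (Im (chi0 k)); nra.
  apply: complex_inj; rewrite -/c ?c2 //.
  by apply/eqP; rewrite -sqrf_eq0; apply/eqP; move: h; rewrite c2 /=; lra.
exfalso.
pose ep := (1 - c) / 2; have ep0 : 0 < ep by rewrite /ep; lra.
have Nk := norma_ge0 NA k.
pose L := 2 * N k + 1.
have [||L0 hL uy] := large_scalar NA (L := L) (f := - k).
- by rewrite /L; lra.
- by rewrite (normaN NA) /L; lra.
set y := L%:C%:A - k in uy.
have Uy : U y = y by exact: U_near.
have yE (chi : character A) : normc (chi y) ^+ 2 = L ^+ 2 + 1 - 2 * L * Re (chi k).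
  have := normc_sqrE (chi k); rewrite nk expr1n => h.
  rewrite normc_sqrE rmorphB /= character_scalar ReD ImD ReN ImN /= sub0r sqrrN.
  by rewrite sqrrB; lra.
pose P := L ^+ 2 + 1 - 2 * L * (1 - ep).
pose Q := L ^+ 2 + 1 - 2 * L * c.
have Lp : 1 <= L by rewrite /L; lra.
have PQ : P < Q by rewrite /P /Q /ep; nra.
have P0 : 0 <= P by rewrite /P; have := sqr_ge0 (L - 1); nra.
have Nf := norma_ge0 NA f.
have [||||n hn] := @geometric_growth R (normc (chi0 f) ^+ 2) (4 * N f ^+ 2) P Q => //.
- by rewrite exprn_gt0 // chi_n0.
- by rewrite mulr_ge0 // exprn_ge0.
pose g := f * y ^+ n.
have ug : g \is a GRing.unit by rewrite unitrM uf unitrX.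
have Ug : U g = g * k by rewrite UM ?unitrX // U_exp // Uf mulrAC.
have Ng := norma_ge0 NA g^-1.
pose t := (2 * N g^-1 + 1)^-1.
have t0 : 0 < t by rewrite invr_gt0; lra.
have Ugd dl : normc dl = t -> dl%:A + g \is a GRing.unit /\
    U (dl%:A + g) = (dl%:A + g) * k.
  move=> hdl; have e : dl%:A + g = g * (1 + dl *: g^-1).
    by rewrite mulrDr mulr1 -scalerAr mulrV // addrC.
  have hN : 2 * N (dl *: g^-1) <= 1.
    rewrite (normaZ NA) hdl /t mulrCA mulrC ler_pdivrMr; last lra.
    by lra.
  have u1 : 1 + dl *: g^-1 \is a GRing.unit by apply: (norma_unit NA); lra.
  rewrite e unitrM ug u1; split => //.
  have Udl : U (1 + dl *: g^-1) = 1 + dl *: g^-1.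
    have := U_near (l := 1) (g := dl *: g^-1) (oner_neq0 _).
    by rewrite normc1 scale1r; apply.
  by rewrite UM // Udl Ug mulrAC.
have m0 := chi_n0 chi0 ug.
pose eta := Num.min (t * ep) (normc (chi0 g) / 2).
have eta0 : 0 < eta by rewrite lt_min mulr_gt0 // divr_gt0.
have etat : eta <= t * ep by rewrite /eta ge_min lexx.
have etam : eta <= normc (chi0 g) / 2 by rewrite /eta ge_min lexx orbT.
have [chim hm] := near_max chi0 g eta0.
set m := normc (chim g) in hm.
have mm0 : normc (chi0 g) <= 2 * m by have := hm chi0; lra.
have m_gt0 : 0 < m by lra.
have [om nom chimE] : exists2 om : R[i], normc om = 1 & chim g = m%:C * om.
  have m0C : m%:C != 0 :> R[i] by rewrite -normc_gt0 normc_real gtr0_norm.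
  exists (chim g / m%:C); last by rewrite mulrC divfK.
  by rewrite normcM normcV normc_real gtr0_norm // divff ?gt_eqF.
have om0 : om != 0 by rewrite -normc_gt0 nom.
pose dl := t%:C * om.
have ndl : normc dl = t by rewrite normcM nom mulr1 normc_real gtr0_norm.
have [udg Udg] := Ugd _ ndl.
have [chi1 h1] := U_spec' chim udg.
have {}h1 : (m + t)%:C * om = chi1 (g * k) + dl * chi1 k.
  have -> : chi1 (g * k) + dl * chi1 k = chi1 (U (dl%:A + g)).
    have e : chi1 (g * k) = chi1 g * chi1 k by rewrite rmorphM.
    by rewrite Udg e [chi1 (_ * k)]rmorphM rmorphD /= character_scalar; ring.
  rewrite -h1 [chim _]rmorphD /= character_scalar chimE /dl rmorphD /=; ring.
have nz : normc (chi1 (g * k)) = normc (chi1 g).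
  by rewrite rmorphM normcM nk mulr1.
have z_le : normc (chi1 g) <= m + eta by exact: hm.
have z_ge : m <= normc (chi1 g).
  have := normcD (chi1 (g * k)) (dl * chi1 k).
  have -> : normc (dl * chi1 k) = t by rewrite normcM ndl nk mulr1.
  rewrite -h1 nz normcM nom mulr1 normc_real gtr0_norm; last lra.
  by lra.
have Rek : 1 - ep <= Re (chi1 k).
  have e : t%:C * chi1 k = (m + t)%:C - chi1 (g * k) / om.
    apply: (mulIf om0); rewrite mulrBl divfK // h1 /dl; ring.
  have := congr1 Re e; rewrite ReD ReN ReM /= mul0r subr0 => e'.
  have := Re_le_normc (chi1 (g * k) / om).
  rewrite normcM normcV nom invr1 mulr1 nz ler_norml => /andP[_ h].
  rewrite -(ler_pM2l t0) e' mulrBr mulr1; lra.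
move: hn; rewrite ltNge => /negP; apply.
have -> : normc (chi0 f) ^+ 2 * Q ^+ n = normc (chi0 g) ^+ 2.
  by rewrite /g rmorphM rmorphXn normcM normcX exprMn -exprM mulnC exprM yE.
have gb : normc (chi1 g) ^+ 2 <= N f ^+ 2 * P ^+ n.
  rewrite /g rmorphM rmorphXn normcM normcX exprMn -exprM mulnC exprM.
  apply: ler_pM; rewrite ?exprn_ge0 ?normc_ge0 //.
    by rewrite lerXn2r ?nnegrE ?normc_ge0 //; exact: character_bound NA chi1 f.
  rewrite lerXn2r ?nnegrE ?exprn_ge0 ?normc_ge0 // yE /P.
  by rewrite lerD2l lerN2 ler_pM2l //; lra.
have : normc (chi0 g) ^+ 2 <= 4 * normc (chi1 g) ^+ 2.
  have -> : 4 * normc (chi1 g) ^+ 2 = (2 * normc (chi1 g)) ^+ 2 by ring.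
  by rewrite lerXn2r ?nnegrE ?mulr_ge0 ?normc_ge0 //; lra.
by lra.
Qed.

End Rigidity.

(** * Group homomorphisms between unit groups *)

Section UnitGroups.
Variables (R : realType) (A B : comUnitAlgType R[i]) (N : A -> R) (NB : B -> R).
Hypotheses (NA : algebra_norm N) (NBA : algebra_norm NB).
Hypothesis ssA : forall x : A, (forall chi : character A, chi x = 0) -> x = 0.
Variable T : {multiplicative unit_group A -> unit_group B}.
Hypothesis surjT : forall g : unit_group B, exists f, T f = g.
Hypothesis specT : forall f, spectrum (unit_val (T f)) = spectrum (unit_val f).

Let unit_valM (C : comUnitRingType) (f g : unit_group C) :
  unit_val (f * g)%g = unit_val f * unit_val g.
Proof. by []. Qed.

Let specTP (f : unit_group A) (psi : character B) :
  exists chi : character A, psi (unit_val (T f)) = chi (unit_val f).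
Proof.
have : spectrum (unit_val (T f)) (psi (unit_val (T f))).
  by apply/(spectrum_characters NBA); exists psi.
by rewrite specT => /(spectrum_characters NA)[chi <-]; exists chi.
Qed.

Let specTP' (f : unit_group A) (chi : character A) :
  exists psi : character B, chi (unit_val f) = psi (unit_val (T f)).
Proof.
have : spectrum (unit_val f) (chi (unit_val f)).
  by apply/(spectrum_characters NA); exists chi.
by rewrite -specT => /(spectrum_characters NBA)[psi <-]; exists psi.
Qed.

Let T_eq1 f : (forall psi : character B, psi (unit_val (T f)) = 1) -> unit_val f = 1.
Proof.
move=> h; apply/eqP; rewrite -subr_eq0; apply/eqP/ssA => chi.
by have [psi e] := specTP' f chi; rewrite rmorphB rmorph1 /= e h subrr.
Qed.

Let T1 : unit_val (T 1%g) = 1.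
Proof.
have e : T (1 * 1)%g = (T 1 * T 1)%g by rewrite gmulfM.
move: e; rewrite mulg1 => /(congr1 (@unit_val B)); rewrite unit_valM => e.
by apply: (mulrI (unit_valP (T 1%g))); rewrite mulr1 -e.
Qed.

(** An element [y] of the radical of [B] gives a unit [1 + y] with spectrum
    reduced to 1; so has its preimage under [T], which is therefore 1. *)
Lemma spectral_semisimple (y : B) : (forall psi : character B, psi y = 0) -> y = 0.
Proof.
move=> y0; have uy : 1 + y \is a GRing.unit.
  apply/(unit_characters NBA) => psi.
  by rewrite rmorphD rmorph1 /= y0 addr0 oner_neq0.
have [f Tf] := surjT (UnitGroup uy).
have f1 : f = 1%g.
  apply: val_inj; apply: T_eq1 => psi.
  by rewrite Tf /= rmorphD rmorph1 /= y0 addr0.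
by have := T1; rewrite -f1 Tf /= => e; apply: (addrI 1); rewrite addr0.
Qed.

Let T_inj : injective T.
Proof.
move=> f g e; pose h := (f * g^-1)%g.
have fE : f = (h * g)%g by rewrite /h mulgVK.
suff -> : f = (1 * g)%g by rewrite mul1g.
rewrite fE; congr (_ * g)%g; apply: val_inj; apply: T_eq1 => psi.
suff -> : unit_val (T h) = 1 by rewrite rmorph1.
have : T (h * g)%g = (T h * T g)%g by rewrite gmulfM.
rewrite -fE e => /(congr1 (@unit_val B)); rewrite unit_valM => e1.
by apply: (mulIr (unit_valP (T g))); rewrite mul1r -e1.
Qed.

Let to_unit (C : comUnitRingType) (x : C) : unit_group C := insubd (unit_group_one C) x.

Let to_unitK (C : comUnitRingType) (x : C) :
  x \is a GRing.unit -> unit_val (to_unit x) = x.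
Proof. by move=> ux; exact: (insubdK (unit_group_one C)). Qed.

Let to_unit_val (C : comUnitRingType) (f : unit_group C) :
  to_unit (unit_val f) = f.
Proof. by apply: val_inj; rewrite /= to_unitK // unit_valP. Qed.

Let to_unitM (C : comUnitRingType) (x y : C) :
  x \is a GRing.unit -> y \is a GRing.unit ->
  to_unit (x * y) = (to_unit x * to_unit y)%g.
Proof.
move=> ux uy; apply: val_inj.
by rewrite /= to_unitK ?unitrM ?ux // !to_unitK.
Qed.

Let Tinv (g : unit_group B) : unit_group A := xget 1%g [set f | T f = g].

Let TinvK g : T (Tinv g) = g.
Proof.
by have [f Tf] := surjT g; rewrite /Tinv; case: xgetP => [//|/(_ f)].
Qed.

Let TK f : Tinv (T f) = f. Proof. by apply: T_inj; rewrite TinvK. Qed.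

Let TinvM g h : Tinv (g * h)%g = (Tinv g * Tinv h)%g.
Proof. by apply: T_inj; rewrite gmulfM !TinvK. Qed.

Let tau (x : A) : B := unit_val (T (to_unit x)).
Let sigma (y : B) : A := unit_val (Tinv (to_unit y)).

Let tau_unit x : tau x \is a GRing.unit. Proof. exact: unit_valP. Qed.

Let tauM x y : x \is a GRing.unit -> y \is a GRing.unit ->
  tau (x * y) = tau x * tau y.
Proof. by move=> ux uy; rewrite /tau to_unitM // gmulfM. Qed.

Let sigmaM x y : x \is a GRing.unit -> y \is a GRing.unit ->
  sigma (x * y) = sigma x * sigma y.
Proof. by move=> ux uy; rewrite /sigma to_unitM // TinvM. Qed.

Let tauK x : x \is a GRing.unit -> sigma (tau x) = x.
Proof. by move=> ux; rewrite /sigma /tau to_unit_val TK to_unitK. Qed.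

Let sigmaK y : y \is a GRing.unit -> tau (sigma y) = y.
Proof. by move=> uy; rewrite /sigma /tau to_unit_val TinvK to_unitK. Qed.

Lemma spectral_isomorphism : exists Phi : {lrmorphism A -> B},
  bijective Phi /\ forall f, Phi (unit_val f) = unit_val (T f).
Proof.
have [|S tS] := @spectral_morphism_extension R A B N NA spectral_semisimple tau tauM.
  move=> x psi ux; have [chi e] := specTP (to_unit x) psi.
  by exists chi; rewrite /tau e to_unitK.
have [|S' sS] := @spectral_morphism_extension R B A NB NBA ssA sigma sigmaM.
  move=> y chi uy; have [psi e] := specTP' (Tinv (to_unit y)) chi.
  by exists psi; rewrite /sigma e TinvK to_unitK.
have SK : cancel S S' by exact: (@extension_cancel R A B N NB NA NBA tau sigma S S' tauK tS sS).
have S'K : cancel S' S by exact: (@extension_cancel R B A NB N NBA NA sigma tau S' S sigmaK sS tS).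
have key x : x \is a GRing.unit -> S' (tau x) = x.
  apply: (@spectral_automorphism_rigid R A N NA ssA (fun x => S' (tau x))).
  - by move=> y z uy uz; rewrite tauM // rmorphM.
  - by move=> y uy; exact: (rmorph_unit S' (tau_unit y)).
  - move=> y chi uy.
    have [chi' e] := specTP (to_unit y) (chi \o S' : character B).
    by exists chi'; rewrite -[LHS]/((chi \o S') (tau y)) e to_unitK.
  - move=> y chi uy; have [psi e] := specTP' (to_unit y) chi.
    rewrite to_unitK // in e.
    by exists (psi \o S : character A); rewrite /= S'K.
  - by move=> l g l0 hg; rewrite tS // SK.
exists S; split; first by exists S'.
move=> f; have := key (unit_val f) (unit_valP f).
by move/(congr1 S); rewrite S'K /tau to_unit_val.
Qed.

End UnitGroups.

Theorem corollary4p3 (R : realType) (A B : comBanachAlgType R[i])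
    (semisimpleA : semisimple (alg A))
    (T : {multiplicative unit_group (alg A) -> unit_group (alg B)})
    (surjT : forall g : unit_group (alg B),
       exists f : unit_group (alg A), T f = g)
    (specT : forall f : unit_group (alg A),
       spectrum (unit_val (T f)) = spectrum (unit_val f)) :
  (exists Phi : {lrmorphism alg A -> alg B},
      bijective Phi /\
      forall f : unit_group (alg A), Phi (unit_val f) = unit_val (T f)) /\
  semisimple (alg B).
Proof.
have NA := banach_algebra_norm A; have NB := banach_algebra_norm B.
have ssA := (semisimpleP NA).1 semisimpleA.
split; first exact: (spectral_isomorphism NA NB ssA surjT specT).
by apply/(semisimpleP NB); exact: (spectral_semisimple NA NB ssA surjT specT).
Qed.
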